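(* Suppose $0<\alpha<4$, $\alpha\neq 2$. Let $\mathbf{\Sigma}$ be a $T\times T$ diagonal matrix with i.i.d. power-law tailed diagonal entries $\sigma_1,\dots,\sigma_T$ with tail exponent $\alpha$. Suppose that $\mathbf{Z}$ is a $T\times S$ matrix, where $T,S\to\infty$ and $\frac{T}{S}\to y$ for some $0<y<\infty$, independent of $\mathbf{\Sigma}$, whose entries are i.i.d., have mean $0$ and variance $1$, and have all moments finite. Let $H$ be the c.d.f. of $\sigma_i^2$ and let $a_T$ be a solution of $1-H(a_T)=\frac1T$. Then, as $T\to\infty$, $$ \frac{\lambda_{\max}\left[\mathbf{\Sigma}\mathbf{Z}\mathbf{Z}^*\mathbf{\Sigma}\right]}{S a_T}\ \longrightarrow\ \xi\quad\text{in distribution}, $$ where $\mathbb{P}(\xi\le x)=\exp\left(-x^{-\alpha/2}\right)$ for $x>0$.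
   Context: A random variable is power-law tailed with tail exponent $\alpha$ if its density $p$ satisfies $p(x)\sim \frac{c}{|x|^{\alpha+1}}$ as $|x|\to\infty$ for some constant $c>0$. The common law of the $\sigma_i$ and the common law of the entries of $\mathbf{Z}$ do not depend on $T,S$. For a Hermitian $N\times N$ matrix $\mathbf{H}$ with eigenvalues $\lambda_1,\dots,\lambda_N$, $\lambda_{\max}[\mathbf{H}]:=\max_{1\le i\le N}|\lambda_i|$. *)

(* Defs.v *)
From HB Require Import structures.
From mathcomp Require Export all_boot all_order all_algebra.
From mathcomp Require Export all_classical all_reals all_analysis.
From mathcomp Require Export complex.

Set Implicit Arguments.
Unset Strict Implicit.
Unset Printing Implicit Defensive.

Import Order.TTheory GRing.Theory Num.Theory.
Import numFieldNormedType.Exports.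

Local Open Scope classical_set_scope.
Local Open Scope ring_scope.
Local Open Scope complex_scope.

(* mu has a density p with p(x) ~ c / |x|^(alpha + 1) as |x| -> oo, i.e. at
   both infinities and with the same constant c. *)
Definition power_law_tailed (R : realType) (mu : probability R R) (alpha : R) :=
  exists p : R -> R,
    [/\ measurable_fun [set: R] p,
        forall x, 0 <= p x,
        forall A : set R, measurable A ->
          mu A = (\int[@lebesgue_measure R]_(x in A) (p x)%:E)%E
      & exists2 c : R, 0 < c &
          (p x / (c / `|x| `^ (alpha + 1)) @[x --> +oo] --> (1 : R)) /\
          (p x / (c / `|x| `^ (alpha + 1)) @[x --> -oo] --> (1 : R))].

Definition has_law (R : realType) (d d' : measure_display)
    (Om : measurableType d) (E : measurableType d') (P : probability Om R)
    (X : {RV P >-> E}) (mu : probability E R) :=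
  forall A : set E, measurable A -> distribution P X A = mu A.

Definition mutually_independent (R : realType) (d d' : measure_display)
    (Om : measurableType d) (E : measurableType d') (P : probability Om R)
    (I : finType) (X : I -> {RV P >-> E}) :=
  forall (J : {set I}) (A : I -> set E), (forall i, measurable (A i)) ->
    P (\bigcap_(i in [set` J]) (X i @^-1` A i)) =
    (\prod_(i in J) P (X i @^-1` A i))%E.

Definition iid (R : realType) (d d' : measure_display)
    (Om : measurableType d) (E : measurableType d') (P : probability Om R)
    (I : finType) (X : I -> {RV P >-> E}) (mu : probability E R) :=
  mutually_independent X /\ forall i, has_law (X i) mu.

Definition family_sigma_algebra (R : realType) (d d' : measure_display)
    (Om : measurableType d) (E : measurableType d') (P : probability Om R)
    (I : Type) (X : I -> {RV P >-> E}) : set (set Om) :=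
  <<s \bigcup_i preimage_set_system [set: Om] (X i) measurable >>.

Definition independent_families (R : realType) (d d1 d2 : measure_display)
    (Om : measurableType d) (E1 : measurableType d1) (E2 : measurableType d2)
    (P : probability Om R) (I1 I2 : Type)
    (X : I1 -> {RV P >-> E1}) (Y : I2 -> {RV P >-> E2}) :=
  forall A B : set Om, family_sigma_algebra X A -> family_sigma_algebra Y B ->
    P (A `&` B) = (P A * P B)%E.

(* A complex random variable is a random variable with values in R * R (with
   its Borel sigma-algebra), read through the identification of R * R with C. *)
Definition to_complex (R : realType) (z : R * R) : R[i] := z.1 +i* z.2.

Definition complex_moment (R : realType) (nu : probability (R * R)%type R)
    (k : nat) (m : R[i]) : \bar R :=
  'E_nu[fun z => Normc.normc (to_complex z - m) ^+ k].

(* [fine] sends infinite expectations to 0, so this is meaningful only when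
   the first absolute moment is finite. *)
Definition complex_mean (R : realType) (nu : probability (R * R)%type R) : R[i] :=
  fine 'E_nu[fst] +i* fine 'E_nu[snd].

Definition complex_variance (R : realType) (nu : probability (R * R)%type R) :
    \bar R :=
  complex_moment nu 2 (complex_mean nu).

Definition all_moments_finite (R : realType) (nu : probability (R * R)%type R) :=
  forall k : nat, (complex_moment nu k 0%R < +oo)%E.

(* The eigenvalues with multiplicity: the roots of the characteristic
   polynomial, which splits over the algebraically closed field R[i]. *)
Definition eigenvalues (R : realType) (N : nat) (H : 'M[R[i]]_N) : seq R[i] :=
  sval (closed_field_poly_normal (char_poly H)).

Definition lambda_max (R : realType) (N : nat) (H : 'M[R[i]]_N) : R :=
  \big[Num.max/0]_(l <- eigenvalues H) Normc.normc l.

Definition diag_matrix (R : realType) (T : nat) (s : 'I_T -> R) : 'M[R[i]]_T :=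
  diag_mx (\row_i (s i)%:C).

Definition complex_matrix (R : realType) (T S : nat) (z : 'I_T -> 'I_S -> R * R) :
    'M[R[i]]_(T, S) :=
  \matrix_(i, j) to_complex (z i j).

Definition adjoint (R : realType) (m n : nat) (A : 'M[R[i]]_(m, n)) :
    'M[R[i]]_(n, m) :=
  map_mx (@Num.conj R[i]) A^T.

Definition cdf_of_square (R : realType) (mu : probability R R) (x : R) : \bar R :=
  mu [set s : R | s ^+ 2 <= x].

(* The probability space may change with n. Convergence in distribution is
   convergence of the distribution functions at the continuity points of the
   limit; the first conjunct says that each X n is a random variable. *)
Definition cvg_in_distribution (R : realType) (d : nat -> measure_display)
    (Om : forall n, measurableType (d n)) (P : forall n, probability (Om n) R)
    (X : forall n, Om n -> R)
    (d' : measure_display) (Om' : measurableType d') (Q : probability Om' R)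
    (xi : {RV Q >-> R}) :=
  (forall n, measurable_fun [set: Om n] (X n)) /\
  forall x : R, {for x, continuous (cdf xi)} ->
    P n (X n @^-1` `]-oo, x]) @[n --> \oo] --> cdf xi x.

(* Main.v *)
From HB Require Import structures.
Require Import Defs.
From mathcomp Require Import all_boot all_order all_algebra.
From mathcomp Require Import all_classical all_reals all_analysis.
From mathcomp Require Import complex ring lra measurable_realfun.
(** Write M for the random matrix Sigma Z Z^H Sigma, s_i for the diagonal entries
of Sigma, Z_i for the rows of Z and b = alpha / 2, so that 0 < b < 2.  The entries
of M are M_ij = s_i s_j <Z_i, Z_j>, and <Z_i, Z_j> is close to S if i = j and to 0
otherwise.  The theorem holds because M is, on the scale S a_T of its largest
diagonal entries, a negligible perturbation of the diagonal matrix with entries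
S s_i^2, and the maximum of i.i.d. variables s_i^2 with a regularly varying tail
has a Frechet limit.

The perturbation is controlled in Frobenius norm, which dominates the change of the
largest absolute eigenvalue ([near_diagonal_lambda_max_le] and
[near_diagonal_le_lambda_max]).  Its square is
  sum_ij s_i^2 s_j^2 |<Z_i, Z_j> - S 1_(i=j)|^2.
By independence of the entries of Z, the mean of |<Z_i, Z_j> - S 1_(i=j)|^2 is S
off the diagonal and S Var |z|^2 on it ([integral_gram_error_offdiag],
[integral_gram_error_diag]).  The s_i^2 need not have a mean, so they are truncated
at K a_T, which changes one of them with probability at most about K^(-b).  If m is
the mean of min(s^2, K a_T), the expected squared norm is at most
  S (T m)^2 + T S Var |z|^2 K a_T m
([mean_truncated_error]), and it has to be compared with (S a_T)^2.  The tail of s^2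
is at most C t^(-g) for every 0 < g <= b, hence m is at most of order a_T^(1-g) when
g < 1 ([truncated_mean_le]); moreover T is of order a_T^b.  Since S and T are
comparable, the two ratios are of order T a_T^(-2g) and a_T^(-g), and both vanish as
soon as b / 2 < g.  An exponent g with b / 2 < g < 1 and g <= b exists exactly
because b < 2, that is alpha < 4 ([perturbation_vanishes]).

What remains is explicit: P(s_i^2 <= x a_T for all i) = (1 - P(s^2 > x a_T))^T, which
tends to exp(- x^(-b)) since T P(s^2 > x a_T) is the ratio of the tail at x a_T to
the tail at a_T ([cvg_exp_compound_quantile]).  Comparing the event that the largest
eigenvalue is at most x S a_T with the same event for the diagonal matrix at the
levels x - eta and x + eta, then letting K tend to infinity and eta to 0, gives the
limit ([lambda_max_prob_bounds], [lambda_max_prob_cvg]). *)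

Set Implicit Arguments.
Unset Strict Implicit.
Unset Printing Implicit Defensive.
Import Order.TTheory GRing.Theory Num.Theory.
Import numFieldNormedType.Exports.

Local Open Scope classical_set_scope.
Local Open Scope ring_scope.

(** * Norms of complex numbers *)

Section ComplexNorm.
Variable R : realType.
Implicit Types z w : R[i].

Lemma normc_ge0 z : 0 <= Normc.normc z.
Proof. by case: z => a b; apply: sqrtr_ge0. Qed.

Lemma normc_gt0 z : (0 < Normc.normc z) = (z != 0).
Proof.
rewrite lt_def normc_ge0 andbT; congr (~~ _); apply/eqP/eqP => [|->].
  exact: Normc.eq0_normc.
exact: Normc.normc0.
Qed.

Lemma normc_real (x : R) : Normc.normc x%:C%C = `|x|.
Proof. by rewrite /= expr0n addr0 sqrtr_sqr. Qed.

Lemma sqr_normcE z : Normc.normc z ^+ 2 = complex.Re z ^+ 2 + complex.Im z ^+ 2.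
Proof. by case: z => a b /=; rewrite sqr_sqrtr// addr_ge0// sqr_ge0. Qed.

Lemma mulc_conj z : z * (z^*)%C = (Normc.normc z ^+ 2)%:C%C.
Proof.
rewrite sqr_normcE; case: z => a b; apply/eqP; rewrite eq_complex /=.
by apply/andP; split; apply/eqP; ring.
Qed.

Lemma normc_sum (I : Type) (r : seq I) (P : pred I) (F : I -> R[i]) :
  Normc.normc (\sum_(i <- r | P i) F i) <= \sum_(i <- r | P i) Normc.normc (F i).
Proof.
elim/big_rec2: _ => [|i x z _ zx]; first by rewrite Normc.normc0.
by rewrite (le_trans (le_normcD _ _))// lerD2l.
Qed.

Lemma normc_conj z : Normc.normc (z^*)%C = Normc.normc z.
Proof. by case: z => a b /=; rewrite sqrrN. Qed.

Lemma adjointE m n (A : 'M[R[i]]_(m, n)) i j : adjoint A i j = ((A j i)^*)%C.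
Proof. by rewrite /adjoint !mxE. Qed.

End ComplexNorm.

(** * Eigenvalues of Hermitian matrices *)

Section Eigenvalues.
Variables (R : realType) (N : nat).
Implicit Types H : 'M[R[i]]_N.

Lemma mem_eigenvalues H l : (l \in eigenvalues H) = eigenvalue H l.
Proof.
rewrite eigenvalue_root_char /eigenvalues; case: closed_field_poly_normal => s /= Hs.
by rewrite Hs (monicP (char_poly_monic H)) scale1r root_prod_XsubC.
Qed.

Lemma lambda_max_ge0 H : 0 <= lambda_max H.
Proof. by rewrite /lambda_max bigmax_idl le_max lexx. Qed.

Lemma le_lambda_max H l : eigenvalue H l -> Normc.normc l <= lambda_max H.
Proof. by rewrite -mem_eigenvalues => lH; apply: le_bigmax_seq. Qed.

Lemma lambda_max_le H (x : R) : 0 <= x ->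
  (forall l, eigenvalue H l -> Normc.normc l <= x) -> lambda_max H <= x.
Proof.
move=> x0 Hx; rewrite /lambda_max big_seq; apply: bigmax_le => // l lH.
by apply: Hx; rewrite -mem_eigenvalues.
Qed.

(** A left eigenvector v of eigenvalue l satisfies v H v^H = l |v|^2. *)
Lemma lambda_max_le_quadratic_form H (x : R) : 0 <= x ->
  (forall v : 'rV_N, Normc.normc ((v *m H *m adjoint v) 0 0) <=
     x * \sum_i Normc.normc (v 0 i) ^+ 2) ->
  lambda_max H <= x.
Proof.
move=> x0 Hx; apply: lambda_max_le => // l /eigenvalueP[v vH v0].
have /rV0Pn[i vi0] := v0.
have := Hx v; rewrite vH -scalemxAl mxE Normc.normcM.
have -> : (v *m adjoint v) 0 0 = (\sum_i Normc.normc (v 0 i) ^+ 2)%:C%C.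
  rewrite mxE rmorph_sum; apply: eq_bigr => j _.
  by rewrite adjointE mulc_conj.
set s := \sum_i _.
have s0 : 0 < s.
  rewrite /s (bigD1 i)//= ltr_pwDl//; last by apply: sumr_ge0 => j _; apply: sqr_ge0.
  by rewrite exprn_gt0// normc_gt0.
by rewrite normc_real gtr0_norm// ler_pM2r.
Qed.

(** The spectral theorem with a real diagonal, in terms of the present notion of
adjoint. *)
Lemma hermitian_spectral H : adjoint H = H ->
  exists (Q : 'M[R[i]]_N) (D : 'rV[R]_N),
    [/\ Q *m adjoint Q = 1%:M, adjoint Q *m Q = 1%:M &
        H = adjoint Q *m diag_mx (map_mx (real_complex R) D) *m Q].
Proof.
move=> HH.
have Hh : H \is hermsymmx.
  by apply/is_hermitianmxP; rewrite expr0 scale1r -[LHS]HH /adjoint ?map_trmx.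
have Hn := hermitian_normalmx Hh.
have /mxOverP Dr := hermitian_spectral_diag_real Hh.
have /orthomx_spectralP HE := Hn.
set Q := spectralmx H in HE; set sp := spectral_diag H in HE Dr.
have Qu : Q \is unitarymx by apply: spectral_unitarymx.
have Qi : invmx Q = adjoint Q by rewrite invmx_unitary// /adjoint ?map_trmx.
have Qun : Q \in unitmx by apply: spectral_unit.
exists Q, (map_mx (@complex.Re R) sp); split.
- by rewrite -Qi mulmxV.
- by rewrite -Qi mulVmx.
- rewrite -Qi [LHS]HE; congr (_ *m diag_mx _ *m _); apply/rowP => j.
  by rewrite !mxE RRe_real.
Qed.

Section Spectral.
Variables (H Q : 'M[R[i]]_N) (D : 'rV[R]_N).
Hypothesis QQ : Q *m adjoint Q = 1%:M.
Hypothesis QQ' : adjoint Q *m Q = 1%:M.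
Hypothesis HE : H = adjoint Q *m diag_mx (map_mx (real_complex R) D) *m Q.

Lemma spectral_le_lambda_max k : `|D 0 k| <= lambda_max H.
Proof.
rewrite -normc_real; apply: le_lambda_max; apply/eigenvalueP; exists (row k Q).
  have QH : Q *m H = diag_mx (map_mx (real_complex R) D) *m Q.
    by rewrite HE !mulmxA QQ mul1mx.
  by rewrite -row_mul QH row_mul row_diag_mx -scalemxAl -rowE mxE.
apply/eqP => Qk0; have : row k (Q *m adjoint Q) = 0 by rewrite row_mul Qk0 mul0mx.
rewrite QQ => /rowP/(_ k); rewrite !mxE eqxx => /eqP.
by rewrite oner_eq0.
Qed.

Lemma lambda_max_le_spectral (x : R) : 0 <= x -> (forall k, `|D 0 k| <= x) -> lambda_max H <= x.
Proof.
move=> x0 Dx; apply: lambda_max_le => // l /eigenvalueP[v vH v0].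
pose w := v *m adjoint Q.
have wD : w *m diag_mx (map_mx (real_complex R) D) = l *: w.
  by rewrite /w scalemxAl -vH HE !mulmxA -[_ *m Q *m adjoint Q]mulmxA QQ mulmx1.
have w0 : w != 0.
  apply: contra_neq v0 => w0.
  by rewrite -[v]mulmx1 -QQ' mulmxA -/w w0 mul0mx.
have /rV0Pn[i wi0] := w0.
clearbody w; move/rowP: wD => /(_ i); rewrite mul_mx_diag !mxE mulrC => /(mulIf wi0) <-.
by rewrite normc_real.
Qed.

Lemma spectral_diag_entry i :
  H i i = (\sum_k D 0 k * Normc.normc (Q k i) ^+ 2)%:C%C.
Proof.
rewrite HE mxE rmorph_sum; apply: eq_bigr => k _.
rewrite mul_mx_diag mxE adjointE mxE rmorphM /= -mulc_conj; ring.
Qed.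

Lemma spectral_col_norm i : \sum_k Normc.normc (Q k i) ^+ 2 = 1.
Proof.
have E : (adjoint Q *m Q) i i = 1 by rewrite QQ' mxE eqxx.
apply: complexI; rewrite -[RHS]/(1 : R[i]) -E mxE rmorph_sum; apply: eq_bigr => k _.
by rewrite adjointE [RHS]mulrC mulc_conj.
Qed.

Lemma spectral_tr_pow m : \tr (H ^+ m) = (\sum_k D 0 k ^+ m)%:C%C.
Proof.
have -> : H ^+ m = adjoint Q *m diag_mx (map_mx (fun x => (x ^+ m)%:C%C) D) *m Q.
  elim: m => [|m IH].
    rewrite expr0 (_ : diag_mx _ = 1%:M) ?mulmx1 ?QQ'//.
    by apply/matrixP => i j; rewrite !mxE expr0.
  rewrite exprSr IH -mulmxE {1}HE !mulmxA -[_ *m Q *m adjoint Q]mulmxA QQ mulmx1.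
  rewrite -[_ *m diag_mx _ *m diag_mx _]mulmxA mulmx_diag; congr (_ *m diag_mx _ *m _).
  by apply/rowP => j; rewrite !mxE exprSr rmorphM.
rewrite mxtrace_mulC mulmxA QQ mul1mx mxtrace_diag rmorph_sum.
by apply: eq_bigr => k _; rewrite mxE.
Qed.
End Spectral.

(** A diagonal entry of H is an average of its eigenvalues, the weights being the
squared moduli of a column of the unitary matrix. *)
Lemma hermitian_diag_le_lambda_max H i : adjoint H = H ->
  Normc.normc (H i i) <= lambda_max H.
Proof.
move=> /hermitian_spectral[Q [D [QQ QQ' HE]]].
rewrite (spectral_diag_entry HE) normc_real (le_trans (ler_norm_sum _ _ _))//.
rewrite -[leRHS]mulr1 -(spectral_col_norm QQ' i) mulr_sumr ler_sum// => k _.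
rewrite normrM [X in _ * X]ger0_norm ?sqr_ge0// ler_wpM2r ?sqr_ge0//.
exact: spectral_le_lambda_max HE _.
Qed.

(** The trace of an even power lies between the same power of the largest absolute
eigenvalue and N times it, so that the even traces determine that eigenvalue.  As
traces of powers are polynomials in the entries, this makes the largest eigenvalue
a measurable function of the matrix. *)
Lemma lambda_max_le_trace H (x : R) : adjoint H = H -> 0 <= x ->
  lambda_max H <= x <-> forall m, Normc.normc (\tr (H ^+ m.*2)) <= N%:R * x ^+ m.*2.
Proof.
move=> /hermitian_spectral[Q [D [QQ QQ' HE]]] x0.
have trE m : Normc.normc (\tr (H ^+ m.*2)) = \sum_k `|D 0 k| ^+ m.*2.
  rewrite (spectral_tr_pow QQ QQ' HE) normc_real.
  rewrite ger0_norm; last first.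
    by apply: sumr_ge0 => k _; rewrite -mul2n exprM exprn_ge0// sqr_ge0.
  by apply: eq_bigr => k _; rewrite -normrX ger0_norm// -mul2n exprM exprn_ge0// sqr_ge0.
split=> [Hx m|Hx].
  rewrite trE.
  apply: (@le_trans _ _ (\sum_(k < N) x ^+ m.*2)).
    apply: ler_sum => k _; apply: lerXn2r; rewrite ?nnegrE//.
    exact: le_trans (spectral_le_lambda_max QQ HE _) Hx.
  by rewrite sumr_const card_ord mulr_natl.
apply: (lambda_max_le_spectral QQ QQ' HE) => // k.
rewrite leNgt; apply/negP => xD.
(* Otherwise N q^(2m) would stay above 1 for a ratio q < 1. *)
have D0 : 0 < `|D 0 k| by exact: le_lt_trans xD.
have D2m m : `|D 0 k| ^+ m.*2 <= N%:R * x ^+ m.*2.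
  by apply: le_trans (Hx m); rewrite trE (bigD1 k)//= lerDl sumr_ge0.
pose q : R := x / `|D 0 k|.
have q1 : `|q| < 1.
  by rewrite /q ger0_norm ?divr_ge0// ltr_pdivrMr// mul1r.
have N1 m : 1 <= N%:R * q ^+ m.*2.
  rewrite /q expr_div_n mulrA ler_pdivlMr ?exprn_gt0// mul1r; exact: D2m.
have : N%:R * q ^+ m.*2 @[m --> \oo] --> (N%:R * 0 : R).
  apply: cvgM; first exact: cvg_cst.
  have -> : (fun m => q ^+ m.*2) = (fun m => (q ^+ 2) ^+ m).
    by apply/funext => m; rewrite -mul2n exprM.
  by apply: cvg_expr; rewrite normrX expr_lt1.
rewrite mulr0 => /cvgrPdist_lt/(_ 1 ltr01)[m _ /(_ m (leqnn m))] /=.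
rewrite sub0r normrN ltNge => /negP; apply.
by rewrite (le_trans (N1 m))// ler_norm.
Qed.

End Eigenvalues.

(** * Perturbations of a diagonal matrix *)

Lemma sum_cauchy_schwarz (R : realDomainType) (I : finType) (a b : I -> R) :
  (\sum_i a i * b i) ^+ 2 <= (\sum_i a i ^+ 2) * (\sum_i b i ^+ 2).
Proof.
have : 0 <= \sum_i \sum_j (a i * b j - a j * b i) ^+ 2.
  by apply: sumr_ge0 => i _; apply: sumr_ge0 => j _; apply: sqr_ge0.
have -> : \sum_i \sum_j (a i * b j - a j * b i) ^+ 2 =
   \sum_i \sum_j a i ^+ 2 * b j ^+ 2 + \sum_i \sum_j b i ^+ 2 * a j ^+ 2
   - 2 * \sum_i \sum_j (a i * b i) * (a j * b j).
  rewrite mulr_sumr -sumrN -!big_split; apply: eq_bigr => i _.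
  rewrite mulr_sumr -sumrN -!big_split; apply: eq_bigr => j _ /=; ring.
rewrite -!big_distrlr /= [X in _ + X - _]mulrC expr2; lra.
Qed.

(** Here H is compared with the diagonal matrix of entries b, and eps bounds the
Frobenius norm of the difference. *)
Section NearDiagonal.
Variables (R : realType) (N : nat) (H : 'M[R[i]]_N) (b : 'I_N -> R) (eps : R).
Let err i j : R := Normc.normc (H i j - ((b i) *+ (i == j))%:C%C).
Hypothesis eps0 : 0 <= eps.
Hypothesis herr : \sum_i \sum_j err i j ^+ 2 <= eps ^+ 2.

(** In the quadratic form of H at v, the diagonal part contributes at most u |v|^2
and, by Cauchy-Schwarz over the pairs of indices, the rest at most eps |v|^2. *)
Lemma near_diagonal_lambda_max_le (u : R) : 0 <= u -> (forall i, `|b i| <= u) ->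
  lambda_max H <= u + eps.
Proof.
move=> u0 bu; apply: lambda_max_le_quadratic_form => [|v]; first exact: addr_ge0.
set B := \sum_i _.
have B0 : 0 <= B by apply: sumr_ge0 => i _; apply: sqr_ge0.
pose nv i := Normc.normc (v 0 i).
have -> : (v *m H *m adjoint v) 0 0 =
    \sum_j \sum_i v 0 i * (H i j - (b i *+ (i == j))%:C%C) * ((v 0 j)^*)%C +
    \sum_j \sum_i v 0 i * (b i *+ (i == j))%:C%C * ((v 0 j)^*)%C.
  rewrite -big_split mxE; apply: eq_bigr => j _ /=.
  rewrite -big_split /= mxE mulr_suml; apply: eq_bigr => i _ /=.
  rewrite adjointE; ring.
rewrite (le_trans (le_normcD _ _))// addrC mulrDl lerD//.
  rewrite (le_trans (normc_sum _ _ _))// mulr_sumr; apply: ler_sum => j _.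
  rewrite (bigD1 j)//= big1 ?addr0; last first.
    by move=> i /negbTE ->; rewrite mulr0n mulr0 mul0r.
  rewrite eqxx mulr1n mulrAC mulc_conj mulrC Normc.normcM !normc_real.
  by rewrite [X in _ * X]ger0_norm ?sqr_ge0// ler_wpM2r ?sqr_ge0.
apply: (@le_trans _ _ (\sum_(p : 'I_N * 'I_N) err p.2 p.1 * (nv p.2 * nv p.1))).
  rewrite -(pair_bigA _ (fun j i => err i j * (nv i * nv j))) /=.
  rewrite (le_trans (normc_sum _ _ _))//; apply: ler_sum => j _.
  rewrite (le_trans (normc_sum _ _ _))//; apply: ler_sum => i _.
  by rewrite !Normc.normcM normc_conj /err /nv; lra.
rewrite -(@ler_pXn2r _ 2)// ?nnegrE ?mulr_ge0//; last first.
  by apply: sumr_ge0 => p _; rewrite !mulr_ge0// normc_ge0.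
rewrite (le_trans (sum_cauchy_schwarz _ _))// exprMn ler_pM//.
- by apply: sumr_ge0 => p _; apply: sqr_ge0.
- by apply: sumr_ge0 => p _; apply: sqr_ge0.
- by rewrite -(pair_bigA _ (fun j i => err i j ^+ 2)) /= exchange_big.
- rewrite -(pair_bigA _ (fun j i => (nv i * nv j) ^+ 2)) /= expr2 /B big_distrlr /=.
  apply: ler_sum => j _; apply: ler_sum => i _; rewrite /nv; lra.
Qed.

Lemma near_diagonal_le_lambda_max i : adjoint H = H -> `|b i| <= lambda_max H + eps.
Proof.
move=> HH.
have : err i i <= eps.
  rewrite -(@ler_pXn2r _ 2)// ?nnegrE ?normc_ge0//; apply: le_trans herr.
  rewrite (bigD1 i)//= (bigD1 i)//= -addrA lerDl addr_ge0//.
    by apply: sumr_ge0 => p _; apply: sqr_ge0.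
  by apply: sumr_ge0 => k _; apply: sumr_ge0 => p _; apply: sqr_ge0.
rewrite /err eqxx mulr1n => Hi; rewrite -normc_real.
have -> : ((b i)%:C)%C = H i i - (H i i - ((b i)%:C)%C) by rewrite opprB addrC subrK.
by rewrite (le_trans (le_normcD _ _))// normcN lerD// hermitian_diag_le_lambda_max.
Qed.
End NearDiagonal.

(** * The scaled Gram matrix *)

Section SampleCovariance.
Variables (R : realType) (T S : nat) (s : 'I_T -> R) (z : 'I_T -> 'I_S -> R * R).

Definition gram i j : R[i] :=
  \sum_k to_complex (z i k) * ((to_complex (z j k))^*)%C.

Definition gram_error i j : R :=
  Normc.normc (gram i j - ((S%:R : R) *+ (i == j))%:C%C) ^+ 2.

Definition scaled_gram : 'M[R[i]]_T :=
  diag_matrix s *m complex_matrix z *m adjoint (complex_matrix z) *m diag_matrix s.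

Lemma scaled_gramE i j : scaled_gram i j = (s i * s j)%:C%C * gram i j.
Proof.
rewrite /scaled_gram /diag_matrix -!mulmxA mul_diag_mx mxE mulmxA mul_mx_diag !mxE.
rewrite rmorphM /= mulrA [RHS]mulrAC; congr (_ * _ * _).
by apply: eq_bigr => k _; rewrite adjointE !mxE.
Qed.

Lemma scaled_gram_hermitian : adjoint scaled_gram = scaled_gram.
Proof.
apply/matrixP => i j; rewrite adjointE !scaled_gramE rmorphM [s j * _]mulrC.
congr (_ * _); first exact: conjc_real.
rewrite /gram rmorph_sum; apply: eq_bigr => k _.
by rewrite [LHS]rmorphM [LHS]mulrC; congr (_ * _); exact: conjcK.
Qed.

Lemma scaled_gram_error i j :
  Normc.normc (scaled_gram i j - ((S%:R * s i ^+ 2) *+ (i == j))%:C%C) ^+ 2 =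
  s i ^+ 2 * s j ^+ 2 * gram_error i j.
Proof.
rewrite scaled_gramE /gram_error.
have -> : ((S%:R * s i ^+ 2) *+ (i == j))%:C%C =
   (s i * s j)%:C%C * (S%:R *+ (i == j))%:C%C :> R[i].
  rewrite -rmorphM; congr (_%:C)%C.
  by case: eqP => [->|_]; rewrite ?mulr0n ?mulr0// !mulr1n; ring.
rewrite -mulrBr Normc.normcM normc_real exprMn real_normK ?num_real//; ring.
Qed.

Variable eps : R.
Hypothesis eps0 : 0 <= eps.
Hypothesis herr : \sum_i \sum_j s i ^+ 2 * s j ^+ 2 * gram_error i j <= eps ^+ 2.

Let herr' : \sum_i \sum_j Normc.normc
  (scaled_gram i j - ((S%:R * s i ^+ 2) *+ (i == j))%:C%C) ^+ 2 <= eps ^+ 2.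
Proof.
apply: le_trans herr; apply: ler_sum => i _; apply: ler_sum => j _.
by rewrite scaled_gram_error.
Qed.

Lemma scaled_gram_lambda_max_le (u : R) : 0 <= u ->
  (forall i, S%:R * s i ^+ 2 <= u) -> lambda_max scaled_gram <= u + eps.
Proof.
move=> u0 su; apply: (near_diagonal_lambda_max_le (b := fun i => S%:R * s i ^+ 2)) => // i.
by rewrite ger0_norm// mulr_ge0// sqr_ge0.
Qed.

Lemma scaled_gram_le_lambda_max i : S%:R * s i ^+ 2 <= lambda_max scaled_gram + eps.
Proof.
apply: le_trans (near_diagonal_le_lambda_max (b := fun i => S%:R * s i ^+ 2) _ _ i _) => //.
  exact: ler_norm.
exact: scaled_gram_hermitian.
Qed.
End SampleCovariance.

(** * Tails of power laws *)

Section Tails.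
Variable R : realType.
Implicit Types a b r x t : R.

Lemma powR_cvgy b : 0 < b -> x `^ b @[x --> +oo] --> +oo.
Proof.
move=> b0; apply/cvgryPge => A.
near=> x.
set M := Num.max A 1; have AM : A <= M by rewrite le_max lexx.
have M0 : 0 <= M by rewrite le_max ler01 orbT.
have x0 : 0 <= x by near: x; apply: nbhs_pinfty_ge; rewrite num_real.
rewrite (le_trans AM)// -[leLHS]powRr1// -(@mulVf _ b) ?gt_eqF// powRrM.
apply: ge0_ler_powR; rewrite ?nnegrE ?powR_ge0 ?ltW//.
Unshelve. all: by end_near. Qed.

Lemma powRN_cvgy b : 0 < b -> x `^ (- b) @[x --> +oo] --> (0 : R).
Proof.
move=> b0; under eq_cvg do rewrite powRN.
apply/gtr0_cvgV0; last exact: powR_cvgy.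
by near=> x; apply: powR_gt0; near: x; apply: nbhs_pinfty_gt; rewrite num_real.
Unshelve. all: by end_near. Qed.

Lemma continuous_powR_gt0 b x : 0 < x -> {for x, continuous (fun u : R => u `^ b)}.
Proof.
move=> x0; apply/differentiable_continuous/derivable1_diffP.
by apply: derivable_powR; rewrite in_itv/= andbT.
Qed.

Lemma integral_powR_tail a r : 0 < a -> 0 < r ->
  (\int[@lebesgue_measure R]_(x in `]r, +oo[) (x `^ (- (a + 1)))%:E
    = (r `^ (- a) / a)%:E)%E.
Proof.
move=> a0 r0; pose F x : R := (- a^-1) *: (x `^ (- a)).
have dF x : 0 < x -> is_derive x 1 F (x `^ (- (a + 1))).
  move=> x0; have h := is_derive1_powR (- a) x0.
  apply: (is_derive_eq (is_deriveZ (- a^-1) h)).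
  rewrite /GRing.scale /= mulrA mulrNN mulVf ?gt_eqF// mul1r.
  by congr (_ `^ _); ring.
have mF : measurable_fun `]r, +oo[ (fun x : R => (x `^ (- (a + 1)))%:E : \bar R).
  by apply/measurable_EFinP; apply: measurable_funTS; exact: measurable_powR.
rewrite (@integral_itv_obnd_cbnd _ _ _ (fun x : R => (x `^ (- (a + 1)))%:E : \bar R))//.
rewrite (@ge0_continuous_FTC2y _ _ F _ 0) //.
- by rewrite /F sub0e -EFinN; congr (_%:E); rewrite /GRing.scale/=; ring.
- by move=> x _; apply: powR_ge0.
- apply: continuous_in_subspaceT => x; rewrite inE/= in_itv/= andbT => rx.
  by apply: continuous_powR_gt0; exact: lt_le_trans rx.
- rewrite /F -(scaler0 _ (- a^-1)); apply: cvgZr.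
  exact: powRN_cvgy.
- by move=> x rx; have [] := dF x (lt_trans r0 rx).
- apply: cvg_at_right_filter; apply: differentiable_continuous.
  by apply/derivable1_diffP; have [] := dF r r0.
- move=> x; rewrite in_itv/= andbT => rx; rewrite derive1E.
  by have [_ ->] := dF x (lt_trans r0 rx).
Qed.

End Tails.

Section DensityTails.
Variable R : realType.
Implicit Types a b r x t : R.

(** Beyond a large r the density is within a factor 1 - d to 1 + d of c x^(-a-1),
whose integral over ]r, +oo[ is c r^(-a) / a. *)
Lemma density_right_tail (p : R -> R) a c : 0 < a -> 0 < c ->
  measurable_fun [set: R] p -> (forall x, 0 <= p x) ->
  p x / (c / `|x| `^ (a + 1)) @[x --> +oo] --> (1 : R) ->
  fine (\int[@lebesgue_measure R]_(x in `]r, +oo[) (p x)%:E)%E * r `^ a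
    @[r --> +oo] --> c / a.
Proof.
move=> a0 c0 mp p0 pc; apply/cvgrPdist_le => e e0.
have ca0 : 0 < c / a by rewrite divr_gt0.
(* A relative error d <= 1 on the density, turned into an absolute error d c / a <= e
   on the limit; d <= 1 keeps the lower bound nonnegative. *)
pose d := Num.min 1 (e / (c / a)).
have d0 : 0 < d by rewrite lt_min ltr01 divr_gt0.
have d1 : d <= 1 by rewrite ge_min lexx.
have de : d * (c / a) <= e.
  by rewrite -ler_pdivlMr// ge_min lexx orbT.
move/cvgrPdist_le : pc => /(_ d d0)[M [_ HM]].
near=> r.
have Mr : M < r by near: r; apply: nbhs_pinfty_gt; rewrite num_real.
have r0 : 0 < r by near: r; apply: nbhs_pinfty_gt; rewrite num_real.
have pb x : r < x -> (1 - d) * c * x `^ (- (a + 1)) <= p x <= (1 + d) * c * x `^ (- (a + 1)).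
  move=> rx; have x0 : 0 < x by exact: lt_trans rx.
  rewrite powRN; have := HM x (lt_trans Mr rx); rewrite (gtr0_norm x0).
  have := powR_gt0 (a + 1) x0; set u := x `^ (a + 1) => u0.
  rewrite distrC ler_distl invf_div mulrA.
  rewrite ler_pdivrMr ?ler_pdivlMr// => /andP[h1 h2].
  by rewrite ler_pdivrMr// h1.
pose q x := (x `^ (- (a + 1)))%:E.
have mq : measurable_fun `]r, +oo[ q.
  by apply/measurable_EFinP; apply: measurable_funTS; exact: measurable_powR.
have q0 x : `]r, +oo[%classic x -> (0 <= q x)%E by move=> _; rewrite lee_fin powR_ge0.
have mp' : measurable_fun `]r, +oo[ (fun x => (p x)%:E).
  by apply/measurable_EFinP; apply: measurable_funTS.
have ub : (\int[@lebesgue_measure R]_(x in `]r, +oo[) (p x)%:E <=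
   ((1 + d) * c * (r `^ (- a) / a))%:E)%E.
  rewrite EFinM -integral_powR_tail// -ge0_integralZl//; last first.
    by rewrite lee_fin mulr_ge0 ?addr_ge0 ?ltW.
  apply: ge0_le_integral => //.
  - by move=> x _; rewrite lee_fin.
  - exact: measurable_funeM.
  - move=> x /=; rewrite in_itv/= andbT => rx.
    by rewrite lee_fin; have /andP[] := pb x rx.
have lb : (((1 - d) * c * (r `^ (- a) / a))%:E <=
   \int[@lebesgue_measure R]_(x in `]r, +oo[) (p x)%:E)%E.
  have k0 : 0 <= (1 - d) * c by rewrite mulr_ge0// ?subr_ge0// ltW.
  rewrite EFinM -integral_powR_tail// -ge0_integralZl//.
  apply: ge0_le_integral => //.
  - by move=> x _; rewrite mule_ge0 ?lee_fin ?powR_ge0.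
  - exact: measurable_funeM.
  - move=> x /=; rewrite in_itv/= andbT => rx.
    by rewrite lee_fin; have /andP[] := pb x rx.
move: ub lb; set I := (\int[_]_(_ in _) _)%E.
have Ifin : (0 <= I)%E by apply: integral_ge0 => x _; rewrite lee_fin.
case: I Ifin => [I| |]// _; rewrite !lee_fin/= => ub lb.
have ra0 : 0 < r `^ a by exact: powR_gt0.
rewrite distrC ler_distl; apply/andP; split.
  apply: (@le_trans _ _ ((1 - d) * c * (r `^ (- a) / a) * r `^ a)).
    rewrite powRN mulrAC [X in _ <= X](_ : _ = (1 - d) * (c / a)); last first.
      by field; rewrite !gt_eqF.
    lra.
  by rewrite ler_pM2r.
apply: (@le_trans _ _ ((1 + d) * c * (r `^ (- a) / a) * r `^ a)).
  by rewrite ler_pM2r.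
rewrite powRN [X in X <= _](_ : _ = (1 + d) * (c / a)); last first.
  by field; rewrite !gt_eqF.
lra.
Unshelve. all: by end_near. Qed.

Definition tail_of_square (mu : probability R R) t : R :=
  fine (mu [set s : R | t < s ^+ 2]).

Lemma measurable_square_gt t : measurable [set s : R | t < s ^+ 2].
Proof.
have -> : [set s : R | t < s ^+ 2] = (fun s : R => s ^+ 2) @^-1` `]t, +oo[.
  by apply/seteqP; split => s /=; rewrite in_itv/= andbT.
rewrite -[X in measurable X]setTI.
have : measurable_fun [set: R] (fun s : R => s ^+ 2) by apply: measurable_funX.
by apply.
Qed.

Lemma integralN_right_tail (p : R -> R) r : measurable_fun [set: R] p -> (forall x, 0 <= p x) ->
  (\int[@lebesgue_measure R]_(x in `]-oo, (- r)%R[) (p x)%:E =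
   \int[@lebesgue_measure R]_(x in `]r, +oo[) (p (- x)%R)%:E)%E.
Proof.
move=> mp p0.
transitivity (\int[pushforward (@lebesgue_measure R) (-%R : R -> measurableTypeR R)]_(x in `]-oo, (- r)%R[) (p x)%:E)%E.
  by apply: eq_measure_integral => //= A mA AS; exact/esym/lebesgue_measureN.
rewrite ge0_integral_pushforward//=; last 2 first.
- by apply/measurable_EFinP; apply: measurable_funTS.
- by move=> x _; rewrite lee_fin.
rewrite (_ : _ @^-1` _ = `]r, +oo[%classic)//.
by apply/seteqP; split => x /=; rewrite !in_itv/= andbT ltrN2.
Qed.

(** The event s^2 > t is the union of two half-lines beyond sqrt t, so both
density tails contribute, and the exponent is halved. *)
Lemma power_law_tail_of_square (mu : probability R R) a : 0 < a ->
  power_law_tailed mu a ->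
  exists2 L : R, 0 < L & tail_of_square mu t * t `^ (a / 2) @[t --> +oo] --> L.
Proof.
move=> a0 [p [mp p0 pE [c c0 [py pNy]]]].
exists (c / a + c / a); first by rewrite addr_gt0// divr_gt0.
have rt := density_right_tail a0 c0 mp p0 py.
have mpN : measurable_fun [set: R] (p \o -%R) by apply: measurableT_comp.
have lt := @density_right_tail (p \o -%R) a c a0 c0 mpN (fun=> p0 _).
have {}lt := lt _.
have {}lt : fine (\int[@lebesgue_measure R]_(x in `]r, +oo[) (p (- x)%R)%:E)%E * r `^ a
    @[r --> +oo] --> c / a.
  apply: lt; move/cvgNy_compNP : pNy => /=; apply: cvg_trans.
  by apply: near_eq_cvg; near=> x; rewrite /= normrN.
have sq : Num.sqrt t @[t --> +oo] --> (+oo : set_system R).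
  apply: cvg_trans (powR_cvgy (_ : 0 < 2^-1)); last by rewrite invr_gt0.
  apply: near_eq_cvg; near=> t.
  have t0 : 0 <= t by near: t; apply: nbhs_pinfty_ge; rewrite num_real.
  by rewrite powR12_sqrt.
have {rt}rt := cvg_comp _ _ sq rt.
have {lt}lt := cvg_comp _ _ sq lt.
apply: cvg_trans (cvgD rt lt); apply: near_eq_cvg; near=> t.
have t0 : 0 < t by near: t; apply: nbhs_pinfty_gt; rewrite num_real.
have -> : t `^ (a / 2) = Num.sqrt t `^ a.
  by rewrite -powR12_sqrt ?ltW// -powRrM mulrC.
rewrite /= -mulrDl; congr (_ * _); rewrite /tail_of_square.
have -> : [set s : R | t < s ^+ 2] = `]Num.sqrt t, +oo[ `|` `]-oo, - Num.sqrt t[.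
  apply/seteqP; split => s /=; rewrite !in_itv/= andbT.
    move=> ts; have : Num.sqrt t < `|s|.
      by rewrite -sqrtr_sqr ltr_sqrt// (lt_trans t0).
    by rewrite ltr_normr ltrNr => /orP.
  move=> st; suff : Num.sqrt t < `|s|.
    move=> ts; rewrite -[ltLHS](sqr_sqrtr (ltW t0)) -[ltRHS]real_normK ?num_real//.
    by rewrite ltr_pXn2r ?nnegrE ?sqrtr_ge0.
  by rewrite ltr_normr ltrNr; apply/orP.
rewrite measureU//; last first.
  rewrite -subset0 => s [] /=; rewrite !in_itv/= andbT => h1 h2.
  have : Num.sqrt t < - Num.sqrt t by exact: lt_trans h2.
  by rewrite ltNge (le_trans _ (sqrtr_ge0 t))// oppr_le0 sqrtr_ge0.
rewrite fineD//= ?fin_num_measure//; congr (fine _ + fine _).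
  by rewrite pE.
by rewrite pE// integralN_right_tail.
Unshelve. all: by end_near. Qed.

End DensityTails.

(** * Regularly varying tails and their quantiles *)

(** The only properties of the tail G of s^2 that matter: it is a nonincreasing
function bounded by 1 and equivalent to L t^(-b).  The number a n is its quantile
at level 1 / T n. *)
Section RegularTail.
Variables (R : realType) (G : R -> R) (b L : R).
Hypothesis b0 : 0 < b.
Hypothesis L0 : 0 < L.
Hypothesis G1 : forall t, G t <= 1.
Hypothesis Gdec : forall s t, s <= t -> G t <= G s.
Hypothesis GL : G t * t `^ b @[t --> +oo] --> L.

Lemma regular_tail_gt0 t : 0 < G t.
Proof.
have : \forall s \near +oo, 0 < G s * s `^ b by exact: (cvgr_gt _ GL).
move=> [M [_ HM]]; pose s := Num.max t (`|M| + 1).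
apply: (@lt_le_trans _ _ (G s)); last by apply: Gdec; rewrite le_max lexx.
have s0 : 0 < s by rewrite lt_max; apply/orP; right; rewrite ltr_pwDr.
have := HM s; rewrite pmulr_lgt0 ?powR_gt0//; apply.
by rewrite lt_max; apply/orP; right; rewrite ltr_pwDr// ler_norm.
Qed.

(** The price of a bound valid for all t > 0 is an exponent g that may be smaller
than b, together with a constant that absorbs the bounded range of t. *)
Lemma regular_tail_le_powR g : 0 < g -> g <= b ->
  exists2 C : R, 0 < C & forall t, 0 < t -> G t <= C * t `^ (- g).
Proof.
move=> g0 gb.
have : \forall s \near +oo, G s * s `^ b < L + 1.
  by apply: (cvgr_lt _ GL); rewrite ltrDl.
(* Beyond m the equivalent takes over; below m the bound follows from G <= 1. *)
move=> [M [_ HM]]; pose m := `|M| + 1.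
have m1 : 1 <= m by rewrite lerDr.
have m0 : 0 < m by exact: lt_le_trans m1.
exists (L + 1 + m `^ g); first by rewrite addr_gt0 ?addr_gt0 ?powR_gt0.
move=> t t0; have tg0 : 0 < t `^ g by exact: powR_gt0.
rewrite powRN ler_pdivlMr//.
have [tm|mt] := leP t m.
  apply: (@le_trans _ _ (1 * m `^ g)).
    apply: ler_pM; [exact/ltW/regular_tail_gt0|exact: ltW|exact: G1|].
    by apply: ge0_ler_powR => //; rewrite ?nnegrE; exact: ltW.
  by rewrite mul1r lerDr addr_ge0 ?ltW.
apply: (@le_trans _ _ (L + 1)); last by rewrite lerDl powR_ge0.
have Mt : M < t.
  by rewrite (le_lt_trans _ mt)// /m (le_trans (ler_norm M))// lerDl.
apply: le_trans (ltW (HM t Mt)); rewrite ler_wpM2l ?(ltW (regular_tail_gt0 t))//.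
by apply: ler_powR; rewrite // (le_trans m1) ?ltW.
Qed.

Variables (T : nat -> nat) (a : nat -> R).
Hypothesis hT : T n @[n --> \oo] --> \oo.
Hypothesis ha : forall n, (0 < T n)%N -> G (a n) = (T n)%:R^-1.

Lemma nat_cvg_gt0 : \forall n \near \oo, (0 < T n)%N.
Proof. by move/cvgnyPge: hT => /(_ 1%N). Qed.

Lemma quantile_cvgy : a n @[n --> \oo] --> +oo.
Proof.
apply/cvgryPgt => K; have GK := regular_tail_gt0 K.
near=> n.
have Tn : (0 < T n)%N by near: n; exact: nat_cvg_gt0.
rewrite ltNge; apply/negP => /Gdec; rewrite ha//; apply/negP; rewrite -ltNge.
rewrite -[ltRHS]invrK ltf_pV2 ?posrE ?invr_gt0 ?ltr0n//.
near: n; move/cvgnyPge : hT => /(_ (Num.truncn (G K)^-1).+1).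
apply: filterS => n; rewrite -(ler_nat R); apply: lt_le_trans.
exact: truncnS_gt.
Unshelve. all: by end_near. Qed.

(** Since T n is the inverse of G (a n), this is the ratio of the tails at u a n and
at a n. *)
Lemma quantile_tail_ratio u : 0 < u ->
  (T n)%:R * G (u * a n) @[n --> \oo] --> u `^ (- b).
Proof.
move=> u0.
have h1 : G (a n) * (a n) `^ b @[n --> \oo] --> L by exact: cvg_comp quantile_cvgy GL.
have h2 : G (u * a n) * (u * a n) `^ b @[n --> \oo] --> L.
  apply: (cvg_comp (fun n => u * a n) _ _ GL).
  apply/cvgryPgt => K; near=> n; rewrite mulrC -ltr_pdivrMr//.
  by near: n; move/cvgryPgt : quantile_cvgy; apply.
have : G (u * a n) * (u * a n) `^ b / (G (a n) * (a n) `^ b) * u `^ (- b)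
    @[n --> \oo] --> L / L * u `^ (- b).
  by apply: cvgM; [apply: cvgM => //; apply: cvgV => //; rewrite gt_eqF|exact: cvg_cst].
rewrite divff ?gt_eqF// mul1r; apply: cvg_trans; apply: near_eq_cvg.
near=> n.
have Tn : (0 < T n)%N by near: n; exact: nat_cvg_gt0.
have an : 0 < a n by near: n; move/cvgryPgt : quantile_cvgy; apply.
rewrite /= ha// powRN powRM ?ltW//.
by field; rewrite !gt_eqF ?powR_gt0 ?ltr0n.
Unshelve. all: by end_near. Qed.

(** T n is of order (a n)^b. *)
Lemma quantile_powR_small g : b < g -> (T n)%:R * (a n) `^ (- g) @[n --> \oo] --> (0 : R).
Proof.
move=> bg.
have h1 : G (a n) * (a n) `^ b @[n --> \oo] --> L by exact: cvg_comp quantile_cvgy GL.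
have h2 : (a n) `^ (- (g - b)) @[n --> \oo] --> (0 : R).
  by apply: cvg_comp quantile_cvgy (powRN_cvgy _); rewrite subr_gt0.
have : (a n) `^ (- (g - b)) / (G (a n) * (a n) `^ b) @[n --> \oo] --> 0 / L.
  by apply: cvgM => //; apply: cvgV => //; rewrite gt_eqF.
rewrite mul0r; apply: cvg_trans; apply: near_eq_cvg.
near=> n.
have Tn : (0 < T n)%N by near: n; exact: nat_cvg_gt0.
have an : 0 < a n by near: n; move/cvgryPgt : quantile_cvgy; apply.
rewrite /= ha// opprB powRB; last by rewrite (gt_eqF an) implybT.
by rewrite powRN; field; rewrite !gt_eqF ?powR_gt0 ?ltr0n.
Unshelve. all: by end_near. Qed.

(** The sandwich exp (- g / (1 - g)) <= 1 - g <= exp (- g), raised to the power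
T n. *)
Lemma cvg_exp_compound (g : nat -> R) c : (forall n, 0 <= g n) ->
  (T n)%:R * g n @[n --> \oo] --> c ->
  (1 - g n) ^+ T n @[n --> \oo] --> expR (- c).
Proof.
move=> g0 hg.
have hTR : (T n)%:R @[n --> \oo] --> (+oo : set_system R).
  by apply: cvg_comp hT _; exact: cvgr_idn.
have gs : g n @[n --> \oo] --> (0 : R).
  have : (T n)%:R * g n / (T n)%:R @[n --> \oo] --> c * 0.
    apply: cvgM => //; apply/gtr0_cvgV0 => //.
    by near=> n; rewrite ltr0n; near: n; exact: nat_cvg_gt0.
  rewrite mulr0; apply: cvg_trans; apply: near_eq_cvg; near=> n.
  have Tn : (0 < T n)%N by near: n; exact: nat_cvg_gt0.
  by rewrite /=; field; rewrite pnatr_eq0 -lt0n.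
have lim0 : expR (- ((T n)%:R * g n)) @[n --> \oo] --> expR (- c).
  by apply: continuous_cvg; [exact: continuous_expR|exact: cvgN].
have lim1 : expR (- ((T n)%:R * g n / (1 - g n))) @[n --> \oo] --> expR (- c).
  apply: continuous_cvg; first exact: continuous_expR.
  apply: cvgN; have -> : c = c / (1 - 0) by rewrite subr0 divr1.
  apply: cvgM => //; apply: cvgV; first by rewrite subr0 oner_eq0.
  by apply: cvgB => //; exact: cvg_cst.
apply: (squeeze_cvgr _ lim1 lim0); near=> n.
have gn1 : g n < 1 by near: n; apply: (cvgr_lt _ gs).
have gn0 : 0 < 1 - g n by rewrite subr_gt0.
rewrite -!mulrA -!mulrN !expRM_natl; apply/andP; split.
  apply: lerXn2r; rewrite ?nnegrE ?expR_ge0 ?(ltW gn0)//.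
  rewrite mulrN expRN -[leRHS]invrK lef_pV2 ?posrE ?expR_gt0 ?invr_gt0//.
  apply: le_trans (expR_ge1Dx _); rewrite le_eqVlt; apply/orP; left; apply/eqP.
  by field; rewrite gt_eqF.
by apply: lerXn2r; rewrite ?nnegrE ?expR_ge0 ?(ltW gn0)// expR_ge1Dx.
Unshelve. all: by end_near. Qed.

Lemma cvg_exp_compound_quantile u : 0 < u ->
  (1 - G (u * a n)) ^+ T n @[n --> \oo] --> expR (- u `^ (- b)).
Proof.
move=> u0; apply: cvg_exp_compound; last exact: quantile_tail_ratio.
by move=> n; exact/ltW/regular_tail_gt0.
Qed.
End RegularTail.

(** * Truncated means *)

Section TruncatedMean.
Variables (R : realType) (mu : probability R R).
Local Notation G := (tail_of_square mu).

Lemma tail_of_square_ge0 t : 0 <= G t.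
Proof. exact/fine_ge0/measure_ge0. Qed.

Lemma tail_of_squareE t : mu [set s : R | t < s ^+ 2] = (G t)%:E.
Proof. by rewrite fineK// fin_num_measure//; exact: measurable_square_gt. Qed.

Lemma tail_of_square_le1 t : G t <= 1.
Proof. by rewrite -lee_fin -tail_of_squareE probability_le1//; exact: measurable_square_gt. Qed.

Lemma tail_of_square_nonincreasing s t : s <= t -> G t <= G s.
Proof.
move=> st; rewrite -lee_fin -!tail_of_squareE le_measure ?inE//; try exact: measurable_square_gt.
by move=> x /=; exact: le_lt_trans.
Qed.

Lemma cdf_of_squareE t : cdf_of_square mu t = (1 - G t)%:E.
Proof.
rewrite /cdf_of_square (_ : [set s : R | _] = ~` [set s : R | t < s ^+ 2]); last first.
  by apply/seteqP; split => s /=; [move=> ?; apply/negP; rewrite -leNgt|move/negP; rewrite -leNgt].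
by rewrite probability_setC ?tail_of_squareE//; exact: measurable_square_gt.
Qed.

Definition truncated_square (u s : R) : R := Num.min (s ^+ 2) u.

Lemma measurable_truncated_square u : measurable_fun [set: R] (truncated_square u).
Proof. by apply: measurable_minr => //; apply: measurable_funX. Qed.

Lemma truncated_square_ge0 u s : 0 <= u -> 0 <= truncated_square u s.
Proof. by move=> u0; rewrite le_min sqr_ge0. Qed.

(** Let f(u) be the mean of min(s^2, u).  Since f(u) <= f(u/2) + (u/2) G(u/2), the
tail bound makes f(u) a geometric sum of ratio 2^(-(1-g)); this is where g < 1 is
needed. *)
Lemma truncated_mean_le (C g u : R) : 0 < C -> 0 < g < 1 ->
  (forall t, 0 < t -> G t <= C * t `^ (- g)) -> 0 < u ->
  (\int[mu]_s (truncated_square u s)%:E <=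
    (C * (2^-1 `^ (1 - g) / (1 - 2^-1 `^ (1 - g))) * u `^ (1 - g))%:E)%E.
Proof.
move=> C0 /andP[g0 g1] HG u0.
set r : R := _ `^ _.
have r0 : 0 < r by apply: powR_gt0; rewrite invr_gt0.
have r1 : r < 1.
  have g10 : 0 < 1 - g by rewrite subr_gt0.
  have := @gt0_ltr_powR R (1 - g) g10 2^-1 1; rewrite !nnegrE powR1; apply => //.
  by rewrite invf_lt1// ltr1n.
have r10 : 0 < 1 - r by rewrite subr_gt0.
set A := C * _.
have A0 : 0 < A by rewrite mulr_gt0// divr_gt0.
(* A is chosen as the fixed point of the halving step. *)
have ArE : (A + C) * r = A by rewrite /A; field; rewrite gt_eqF.
(* After m halvings what is left of the mean is at most u / 2^m. *)
have step m : forall u, 0 < u -> (\int[mu]_s (truncated_square u s)%:E <=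
    (A * u `^ (1 - g) + u / 2 ^+ m)%:E)%E.
  elim: m => [|m IH] {u0} u u0.
    rewrite expr0 divr1; apply: (@le_trans _ _ (\int[mu]_s (cst u%:E s))%E).
      apply: ge0_le_integral => //.
      - by move=> s _; rewrite lee_fin truncated_square_ge0// ltW.
      - by apply/measurable_EFinP; exact: measurable_truncated_square.
      - by move=> s _; rewrite lee_fin ge_min lexx orbT.
    rewrite (@integral_cst _ _ _ mu _ measurableT).
    rewrite [X in (_ * X)%E](_ : _ = 1%E); last exact: (probability_setT mu).
    by rewrite mule1 lee_fin lerDr mulr_ge0 ?powR_ge0// ltW.
  have u20 : 0 < u / 2 by rewrite divr_gt0.
  have mI := measurable_square_gt (u / 2).
  apply: (@le_trans _ _ (\int[mu]_s ((truncated_square (u / 2) s)%:E +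
     (u / 2)%:E * (\1_[set s : R | (u / 2 < s ^+ 2)%R] s)%:E))%E).
    apply: ge0_le_integral => //.
    - by move=> s _; rewrite lee_fin truncated_square_ge0// ltW.
    - by apply/measurable_EFinP; exact: measurable_truncated_square.
    - apply: emeasurable_funD; first by apply/measurable_EFinP; exact: measurable_truncated_square.
      by apply: measurable_funeM; apply/measurable_EFinP; exact: measurable_indic.
    - move=> s _; rewrite -EFinM -EFinD lee_fin indicE /truncated_square.
      have [su|us] := leP (s ^+ 2) (u / 2).
        rewrite memNset /=; last by apply/negP; rewrite -leNgt.
        by rewrite mulr0 addr0 ge_min lexx.
      by rewrite mem_set// mulr1 ge_min; apply/orP; right; lra.
  rewrite ge0_integralD//; last 4 first.
  - by move=> s _; rewrite lee_fin truncated_square_ge0// ltW.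
  - by apply/measurable_EFinP; exact: measurable_truncated_square.
  - by move=> s _; rewrite mule_ge0// lee_fin ltW.
  - by apply: measurable_funeM; apply/measurable_EFinP; exact: measurable_indic.
  rewrite ge0_integralZl//; last 2 first.
  - by apply/measurable_EFinP; exact: measurable_indic.
  - by rewrite lee_fin ltW.
  rewrite [X in (_ + _ * X)%E](_ : _ = (G (u / 2))%:E); last first.
    by rewrite integral_indic// setIT; exact: tail_of_squareE.
  apply: le_trans (leeD (IH _ u20) (lexx _)) _.
  rewrite -EFinM -EFinD lee_fin.
  have -> : A * u `^ (1 - g) = (A + C) * (u / 2) `^ (1 - g).
    by rewrite powRM ?ltW// -/r [_ * r]mulrC mulrA ArE.
  have E1 : u / 2 * (C * (u / 2) `^ (- g)) = C * (u / 2) `^ (1 - g).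
    rewrite powRD; last by rewrite (gt_eqF u20) implybT.
    by rewrite powRr1 ?(ltW u20)//; ring.
  have E2 : u / 2 / 2 ^+ m = u / 2 ^+ m.+1.
    by rewrite exprS invfM mulrA.
  have := ler_wpM2l (ltW u20) (HG _ u20); rewrite E1 -E2; lra.
apply/lee_addgt0Pr => e e0.
pose m := (Num.truncn (u / e)).+1.
apply: le_trans (step m u u0) _; rewrite -EFinD lee_fin lerD2l.
rewrite ler_pdivrMr ?exprn_gt0// mulrC -ler_pdivrMr//.
apply: (@le_trans _ _ m%:R); first by exact/ltW/truncnS_gt.
by rewrite -natrX ler_nat ltnW// ltn_expl.
Qed.
End TruncatedMean.

(** * Expectations of products of independent variables *)

Section IndependentProduct.
Context d (Om : measurableType d) (R : realType) (P : probability Om R).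

Definition independent_functions (X Y : Om -> R) := forall A B : set R,
  measurable A -> measurable B ->
  P (X @^-1` A `&` Y @^-1` B) = (P (X @^-1` A) * P (Y @^-1` B))%E.

Variables X Y : Om -> R.
Hypothesis mX : measurable_fun [set: Om] X.
Hypothesis mY : measurable_fun [set: Om] Y.
Hypothesis XY : independent_functions X Y.

Let Xrv : {RV P >-> R} := HB.pack X (isMeasurableFun.Build _ _ _ _ _ mX).
Let Yrv : {RV P >-> R} := HB.pack Y (isMeasurableFun.Build _ _ _ _ _ mY).
Let XYf w := (X w, Y w).
Let mXY : measurable_fun [set: Om] XYf.
Proof. exact: measurable_fun_pair. Qed.

Let joint_law A : measurable A ->
  (distribution P Xrv \x distribution P Yrv)%E A = pushforward P XYf A.
Proof.
apply: (product_measure_unique (m' := pushforward P XYf)) => B C mB mC.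
exact: XY.
Qed.

(** The joint law of X and Y is the product of their laws, because it is so on
rectangles; the Tonelli theorem does the rest. *)
Lemma ge0_integral_independentM (f g : R -> \bar R) :
  measurable_fun [set: R] f -> measurable_fun [set: R] g ->
  (forall x, 0 <= f x)%E -> (forall x, 0 <= g x)%E ->
  (\int[P]_w (f (X w) * g (Y w)) = \int[P]_w f (X w) * \int[P]_w g (Y w))%E.
Proof.
move=> mf mg f0 g0.
pose h (z : R * R) := (f z.1 * g z.2)%E.
have mh : measurable_fun [set: R * R] h.
  by apply: emeasurable_funM; apply: measurableT_comp.
transitivity (\int[distribution P Xrv \x distribution P Yrv]_z h z)%E.
  transitivity (\int[pushforward P XYf]_z h z)%E.
    by rewrite ge0_integral_pushforward//= => z _; exact: mule_ge0.
  by apply: eq_measure_integral => A mA _; exact/esym/joint_law.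
rewrite fubini_tonelli1//; last by move=> z; exact: mule_ge0.
rewrite /fubini_F /h /=.
under eq_integral do rewrite ge0_integralZl//.
rewrite ge0_integralZr//; last exact: integral_ge0.
by rewrite !ge0_integral_distribution.
Qed.

(** The absolute values make the integrand nonnegative on the whole plane without
changing it on the range of X and Y. *)
Lemma nonneg_integral_independentM : (forall w, 0 <= X w) -> (forall w, 0 <= Y w) ->
  (\int[P]_w (X w * Y w)%:E = \int[P]_w (X w)%:E * \int[P]_w (Y w)%:E)%E.
Proof.
move=> X0 Y0; pose f (x : R) : \bar R := `|x%:E|%E.
have mf : measurable_fun [set: R] f by apply: measurableT_comp => //; apply: measurableT_comp.
have := ge0_integral_independentM mf mf (fun=> abse_ge0 _) (fun=> abse_ge0 _).
have fE (U : Om -> R) w : (forall w, 0 <= U w) -> f (U w) = (U w)%:E.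
  by move=> U0; rewrite /f gee0_abs// lee_fin.
rewrite (_ : (\int[P]_w (f (X w) * f (Y w)) = \int[P]_w (X w * Y w)%:E)%E).
  move=> ->; congr (_ * _)%E; apply: eq_integral => w _; exact: fE.
by apply: eq_integral => w _; rewrite !fE// EFinM.
Qed.

Lemma integrable_independentM : P.-integrable [set: Om] (EFin \o X) ->
  P.-integrable [set: Om] (EFin \o Y) ->
  P.-integrable [set: Om] (fun w => (X w * Y w)%:E).
Proof.
move=> /integrableP[_ iX] /integrableP[_ iY]; apply/integrableP; split.
  by apply/measurable_EFinP; exact: measurable_funM.
under eq_integral do rewrite EFinM abseM.
rewrite (ge0_integral_independentM (f := fun x => `|x%:E|%E) (g := fun x => `|x%:E|%E))//.
- by rewrite lte_mul_pinfty// ?ge0_fin_numE ?integral_ge0.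
- by apply: measurableT_comp => //; apply: measurableT_comp.
- by apply: measurableT_comp => //; apply: measurableT_comp.
Qed.

Lemma integral_independentM : P.-integrable [set: Om] (EFin \o X) ->
  P.-integrable [set: Om] (EFin \o Y) ->
  (\int[P]_w (X w * Y w)%:E = \int[P]_w (X w)%:E * \int[P]_w (Y w)%:E)%E.
Proof.
move=> iX iY; have iXY := integrable_independentM iX iY.
pose h (z : R * R) := (z.1 * z.2)%:E.
have mh : measurable_fun [set: R * R] h.
  by apply/measurable_EFinP; apply: measurable_funM.
have eqm A : measurable A -> A `<=` setT ->
  (distribution P Xrv \x distribution P Yrv)%E A = pushforward P XYf A.
  by move=> mA _; exact: joint_law.
have ih : (distribution P Xrv \x distribution P Yrv)%E.-integrable setT h.
  have : (pushforward P XYf).-integrable setT h by exact: integrable_pushforward.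
  move=> /integrableP[_ hoo]; apply/integrableP; split => //.
  by rewrite (eq_measure_integral _ eqm).
transitivity (\int[distribution P Xrv \x distribution P Yrv]_z h z)%E.
  by rewrite (eq_measure_integral _ eqm) integral_pushforward.
rewrite -integral12_prod_meas1// /fubini_F /h /=.
have iYd : (distribution P Yrv).-integrable setT (EFin : R -> \bar R).
  exact: integrable_pushforward.
have iXd : (distribution P Xrv).-integrable setT (EFin : R -> \bar R).
  exact: integrable_pushforward.
under eq_integral do under eq_integral do rewrite EFinM.
under eq_integral do rewrite integralZl//.
have -> : (\int[distribution P Yrv]_y y%:E = \int[P]_w (Y w)%:E)%E.
  by rewrite integral_distribution.
have : (\int[P]_w (Y w)%:E)%E \is a fin_num by exact: integrable_fin_num.
move=> /fineK <-; rewrite integralZr//.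
by rewrite integral_distribution.
Qed.

End IndependentProduct.

(** * One variable against all the others *)

Section GeneratedIndependence.
Context d (Om : measurableType d) (R : realType) (P : probability Om R).

Lemma measurable_preimage d' (E : measurableType d') (X : {RV P >-> E}) A :
  measurable A -> measurable (X @^-1` A).
Proof.
move=> mA; exact: (@measurable_funPTI _ _ Om E X A mA).
Qed.

(** Measurability for the sigma-algebra generated by G, stated on the type that
carries this sigma-algebra so that the closure properties of measurable functions
apply as they are. *)
Definition generated_measurable (G : set (set Om)) d' (E : measurableType d') (X : Om -> E) :=
  measurable_fun [set: g_sigma_algebraType G] (X : g_sigma_algebraType G -> E).

Lemma generated_measurable_mem (G : set (set Om)) d' (E : measurableType d') (X : Om -> E) :
  preimage_set_system [set: Om] X measurable `<=` G -> generated_measurable G X.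
Proof.
move=> XG _ B mB; rewrite setTI; apply: sub_sigma_algebra; apply: XG.
by exists B => //; rewrite setTI.
Qed.

Lemma generated_measurable_sub (G : set (set Om)) d' (E : measurableType d') (X : Om -> E) :
  G `<=` measurable -> generated_measurable G X -> measurable_fun [set: Om] X.
Proof.
move=> Gm mX _ B mB; rewrite setTI.
apply: (smallest_sub (@sigma_algebra_measurable _ Om) Gm).
by rewrite -[_ @^-1` _]setTI; exact: mX.
Qed.

Lemma independent_functions_generated (G1 G2 : set (set Om)) (X Y : Om -> R) :
  (forall A B, <<s G1 >> A -> <<s G2 >> B -> P (A `&` B) = (P A * P B)%E) ->
  generated_measurable G1 X -> generated_measurable G2 Y -> independent_functions P X Y.
Proof.
move=> G12 mX mY A B mA mB; apply: G12.
  by rewrite -[_ @^-1` _]setTI; exact: mX.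
by rewrite -[_ @^-1` _]setTI; exact: mY.
Qed.

Section OneVersusOthers.
Context d' (E : measurableType d') (I : finType) (Z : I -> {RV P >-> E}).
Hypothesis indep : mutually_independent Z.
Variable i0 : I.

(** A family generating the sigma-algebra of all the variables except Z i0. *)
Definition others : set (set Om) :=
  \bigcup_(j in [set j | j != i0]) preimage_set_system [set: Om] (Z j) measurable.

Let cylinder : set (set Om) := [set B | exists2 F : I -> set E, (forall j, measurable (F j)) &
  B = \bigcap_(j in [set j | j != i0]) (Z j @^-1` F j)].

Let cylinder_measurable : cylinder `<=` measurable.
Proof.
move=> _ [F mF ->]; apply: fin_bigcap_measurable => [|j _]; first exact: finite_finset.
exact: measurable_preimage.
Qed.

Let others_cylinder : others `<=` cylinder.
Proof.
move=> _ [j ji0 [B mB <-]]; exists (fun k => if k == j then B else setT).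
  by move=> k; case: ifP.
rewrite setTI; apply/seteqP; split => [w Bw k _ /=|w /(_ j ji0)/=]; last by rewrite eqxx.
by case: eqP => // ->.
Qed.

(** Both sides are finite measures in B.  They agree on the cylinders, which are
stable under intersection and generate the sigma-algebra of the other variables. *)
Lemma independent_one_others A B : measurable A -> <<s others >> B ->
  P (Z i0 @^-1` A `&` B) = (P (Z i0 @^-1` A) * P B)%E.
Proof.
move=> mA oB.
have mZA : measurable (Z i0 @^-1` A).
  exact: measurable_preimage.
have c0 : 0 <= fine (P (Z i0 @^-1` A)) by exact/fine_ge0/measure_ge0.
pose c : {nonneg R} := NngNum c0.
pose m1 : {measure set Om -> \bar R} := mrestr P mZA.
pose m2 : {measure set Om -> \bar R} := mscale c P.
have : m1 B = m2 B.
  apply: (@g_sigma_algebra_measure_unique _ _ _ cylinder _ (fun=> setT)) => //.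
  - move=> _; exists (fun=> setT) => //.
    by apply/seteqP; split.
  - by rewrite bigcup_const//; exists 0%N.
  - move=> _ _ [F mF ->] [F' mF' ->]; exists (fun j => F j `&` F' j).
      by move=> j; exact: measurableI.
    by rewrite -bigcapI.
  - move=> _ [F mF ->].
    rewrite /m1 /m2 /= /mrestr /mscale /=.
    pose F1 j := if j == i0 then A else F j.
    have mF1 j : measurable (F1 j) by rewrite /F1; case: ifP.
    have := @indep [set: I]%SET F1 mF1; have := @indep [set~ i0]%SET F1 mF1.
    rewrite (_ : \bigcap_(i in [set` [set~ i0]%SET]) _ =
      \bigcap_(j in [set j | j != i0]) Z j @^-1` F j); last first.
      apply/seteqP; split => [w Hw j /= ji0|w Hw j /= ji0].
        by have := Hw j; rewrite /F1 /= !inE ji0 (negbTE ji0); apply.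
      by move: ji0; rewrite !inE => ji0; rewrite /F1 (negbTE ji0); exact: Hw.
    move=> E1; rewrite (_ : \bigcap_(i in [set` [set: I]%SET]) _ =
      \bigcap_(j in [set j | j != i0]) Z j @^-1` F j `&` Z i0 @^-1` A); last first.
      apply/seteqP; split => [w Hw|w [Hw Aw] j _].
        split; last by have := Hw i0; rewrite /F1 /= inE eqxx; apply.
        by move=> j /= ji0; have := Hw j; rewrite /F1 /= inE (negbTE ji0); apply.
      by rewrite /F1 /=; case: eqP => [->//|/eqP ji0]; exact: Hw.
    move=> ->; rewrite (bigD1 i0) ?inE//= {1}/F1 eqxx fineK ?fin_num_measure//.
    by rewrite E1; congr (_ * _)%E; apply: eq_bigl => j; rewrite !inE.
  - by move=> k; rewrite /m1 /= /mrestr setTI ltey_eq fin_num_measure.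
  - move: oB; apply: sub_smallest2r => //; exact: smallest_sigma_algebra.
rewrite /m1 /m2 /= /mrestr /mscale /= setIC => ->.
by rewrite fineK// fin_num_measure.
Qed.

Lemma independent_functions_one_others (f : E -> R) (Y : Om -> R) :
  measurable_fun [set: E] f -> generated_measurable others Y ->
  independent_functions P (f \o Z i0) Y.
Proof.
move=> mf mY A B mA mB; rewrite comp_preimage independent_one_others//.
  by rewrite -[_ @^-1` _]setTI; exact: mf.
by rewrite -[_ @^-1` _]setTI; exact: mY.
Qed.

End OneVersusOthers.
End GeneratedIndependence.

(** * Orthogonal square-integrable variables *)

Section SquareIntegrable.
Context d (Om : measurableType d) (R : realType) (P : probability Om R).
Implicit Types U V : Om -> R.

Definition square_integrable U :=
  measurable_fun [set: Om] U /\ P.-integrable [set: Om] (fun w => (U w ^+ 2)%:E).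

Lemma integrable_le (U V : Om -> R) : measurable_fun [set: Om] U ->
  (forall w, `|U w| <= V w) -> P.-integrable [set: Om] (EFin \o V) ->
  P.-integrable [set: Om] (EFin \o U).
Proof.
move=> mU UV; apply: le_integrable => //; first exact/measurable_EFinP.
by move=> w _; rewrite /= lee_fin (le_trans (UV w))// ler_norm.
Qed.

Lemma integrableD_fin U V : P.-integrable [set: Om] (EFin \o U) ->
  P.-integrable [set: Om] (EFin \o V) ->
  P.-integrable [set: Om] (fun w => (U w + V w)%:E).
Proof. by move=> iU iV; exact: (integrableD measurableT iU iV). Qed.

Lemma square_integrable_le U (V : Om -> R) : measurable_fun [set: Om] U ->
  (forall w, U w ^+ 2 <= V w) -> P.-integrable [set: Om] (EFin \o V) ->
  square_integrable U.
Proof.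
move=> mU UV iV; split => //; apply: (integrable_le _ _ iV).
  exact: measurable_funX.
by move=> w; rewrite ger0_norm ?sqr_ge0.
Qed.

(** |U V| <= U^2 + V^2. *)
Lemma square_integrableM U V : square_integrable U -> square_integrable V ->
  P.-integrable [set: Om] (fun w => (U w * V w)%:E).
Proof.
move=> [mU iU] [mV iV]; apply: (integrable_le (V := fun w => U w ^+ 2 + V w ^+ 2)).
- exact: measurable_funM.
- move=> w; rewrite normrM -[U w ^+ 2]real_normK ?num_real//.
  rewrite -[V w ^+ 2]real_normK ?num_real//.
  have := sqr_ge0 (`|U w| - `|V w|); have := sqr_ge0 `|U w|; have := sqr_ge0 `|V w|.
  rewrite sqrrB mulr2n; lra.
- exact: integrableD_fin.
Qed.

Lemma integral_sqr_sum_orthogonal (n : nat) (U : 'I_n -> Om -> R) :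
  (forall k, square_integrable (U k)) ->
  (forall k l, k != l -> (\int[P]_w (U k w * U l w)%:E = 0)%E) ->
  (\int[P]_w ((\sum_k U k w) ^+ 2)%:E = \sum_k \int[P]_w (U k w ^+ 2)%:E)%E.
Proof.
move=> sU oU.
transitivity (\int[P]_w (\sum_k \sum_l (U k w * U l w)%:E))%E.
  apply: eq_integral => w _; rewrite expr2 big_distrlr /= -sumEFin.
  by apply: eq_bigr => k _; rewrite -sumEFin.
rewrite integral_sum//; last first.
  by move=> k; apply: integrable_sum => // l _; exact: square_integrableM.
apply: eq_bigr => k _; rewrite integral_sum//; last first.
  by move=> l; exact: square_integrableM.
rewrite (bigD1 k)//= big1 ?adde0//.
by move=> l lk; rewrite oU// eq_sym.
Qed.

End SquareIntegrable.

(** * Moments of the entries *)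

Section Law.
Context d d' (Om : measurableType d) (E : measurableType d') (R : realType).
Variable P : probability Om R.
Variables (nu : probability E R) (X : {RV P >-> E}).
Hypothesis lawX : has_law X nu.

Lemma ge0_integral_law (f : E -> \bar R) : measurable_fun [set: E] f ->
  (forall z, 0 <= f z)%E -> (\int[P]_w f (X w) = \int[nu]_z f z)%E.
Proof.
move=> mf f0; rewrite -[LHS](@ge0_integral_distribution _ _ _ _ _ P X f)//.
by apply: eq_measure_integral => A mA _; exact: lawX.
Qed.

Lemma integrable_law (f : E -> R) : nu.-integrable [set: E] (EFin \o f) ->
  P.-integrable [set: Om] (fun w => (f (X w))%:E).
Proof.
move=> /integrableP[mf foo]; apply/integrableP; split.
  by apply: (measurableT_comp mf); exact: measurable_funP.
rewrite (ge0_integral_law (f := fun z => `|(f z)%:E|%E))//.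
exact: measurableT_comp.
Qed.

Lemma integral_law (f : E -> R) : nu.-integrable [set: E] (EFin \o f) ->
  (\int[P]_w (f (X w))%:E = \int[nu]_z (f z)%:E)%E.
Proof.
move=> /[dup] fi /integrableP[mf foo].
rewrite -(@integral_distribution _ _ _ _ _ P X (EFin \o f))//; last exact: integrable_law.
by apply: eq_measure_integral => A mA _; exact: lawX.
Qed.
End Law.

Section EntryMoments.
Variable R : realType.
Variable nu : probability (R * R)%type R.

Definition sqnorm (z : R * R) : R := z.1 ^+ 2 + z.2 ^+ 2.

(** The variance of |z|^2, since its mean is 1. *)
Definition sqnorm_variance : \bar R := (\int[nu]_z ((sqnorm z - 1) ^+ 2)%:E)%E.

Lemma sqnorm_ge0 z : 0 <= sqnorm z.
Proof. by rewrite addr_ge0// sqr_ge0. Qed.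

Lemma measurable_sqnorm : measurable_fun [set: R * R] sqnorm.
Proof.
by apply: measurable_funD; apply: measurable_funX; [exact: measurable_fst|exact: measurable_snd].
Qed.

Lemma sqnormE z : Normc.normc (to_complex z) ^+ 2 = sqnorm z.
Proof. by rewrite sqr_normcE. Qed.

Hypothesis nu_moments : all_moments_finite nu.
Hypothesis nu_mean : complex_mean nu = 0.
Hypothesis nu_var : complex_variance nu = 1%E.

Lemma integral_sqnorm : (\int[nu]_z (sqnorm z)%:E = 1)%E.
Proof.
rewrite -nu_var /complex_variance /complex_moment nu_mean unlock.
by apply: eq_integral => z _; rewrite subr0 sqnormE.
Qed.

Lemma integrable_sqnorm : nu.-integrable [set: R * R] (fun z => (sqnorm z)%:E).
Proof.
apply/integrableP; split; first by apply/measurable_EFinP; exact: measurable_sqnorm.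
under eq_integral do rewrite gee0_abs ?lee_fin ?sqnorm_ge0//.
by rewrite integral_sqnorm ltry.
Qed.

Lemma integrable_sqnorm_sqr : nu.-integrable [set: R * R] (fun z => (sqnorm z ^+ 2)%:E).
Proof.
apply/integrableP; split.
  by apply/measurable_EFinP; apply: measurable_funX; exact: measurable_sqnorm.
under eq_integral do rewrite gee0_abs ?lee_fin ?sqr_ge0//.
have := nu_moments 4; rewrite /complex_moment unlock; apply: le_lt_trans.
rewrite le_eqVlt; apply/orP; left; apply/eqP.
by apply: eq_integral => z _; rewrite subr0 -sqnormE -exprM.
Qed.

Lemma integrable_coordinate (f : R * R -> R) : measurable_fun [set: R * R] f ->
  (forall z, f z ^+ 2 <= sqnorm z) -> nu.-integrable [set: R * R] (EFin \o f).
Proof.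
move=> mf fn; apply: (@integrable_le _ _ _ nu f (fun z => 1 + sqnorm z)) => //.
  move=> z; have := fn z; rewrite -[f z ^+ 2]real_normK ?num_real//.
  have := sqr_ge0 (`|f z| - 1); rewrite sqrrB mulr1 expr1n mulr2n.
  have := normr_ge0 (f z); lra.
apply: integrableD_fin; last exact: integrable_sqnorm.
exact: finite_measure_integrable_cst.
Qed.

(** The mean is defined through [fine], which would also give 0 for an infinite
integral: integrability has to be known first. *)
Lemma integral_fst_eq0 : (\int[nu]_z (z.1)%:E = 0)%E.
Proof.
have i : nu.-integrable [set: R * R] (EFin \o fst).
  by apply: integrable_coordinate; [exact: measurable_fst|move=> z; rewrite lerDl sqr_ge0].
have := nu_mean; rewrite /complex_mean unlock => -[h _].
by rewrite -[LHS]fineK ?h// (integrable_fin_num measurableT i).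
Qed.

Lemma integral_snd_eq0 : (\int[nu]_z (z.2)%:E = 0)%E.
Proof.
have i : nu.-integrable [set: R * R] (EFin \o snd).
  by apply: integrable_coordinate; [exact: measurable_snd|move=> z; rewrite lerDr sqr_ge0].
have := nu_mean; rewrite /complex_mean unlock => -[_ h].
by rewrite -[LHS]fineK ?h// (integrable_fin_num measurableT i).
Qed.

Lemma integrable_sqnorm_centered_sqr :
  nu.-integrable [set: R * R] (fun z => ((sqnorm z - 1) ^+ 2)%:E).
Proof.
apply: (@integrable_le _ _ _ nu (fun z => (sqnorm z - 1) ^+ 2) (fun z => 1 + sqnorm z ^+ 2)) => //.
- by apply: measurable_funX; apply: measurable_funB => //; exact: measurable_sqnorm.
- move=> z; rewrite ger0_norm ?sqr_ge0// sqrrB mulr1 expr1n mulr2n.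
  have := sqnorm_ge0 z; lra.
apply: integrableD_fin; last exact: integrable_sqnorm_sqr.
exact: finite_measure_integrable_cst.
Qed.

Lemma sqnorm_variance_fin_num : sqnorm_variance \is a fin_num.
Proof. exact: (integrable_fin_num measurableT integrable_sqnorm_centered_sqr). Qed.
End EntryMoments.

(** * Mean square error of the Gram matrix *)

Section GramErrorFormula.
Variables (R : realType) (T S : nat) (z : 'I_T -> 'I_S -> R * R).

Definition cross_re (u v : R * R) : R := u.1 * v.1 + u.2 * v.2.
(** Written as a sum of products of a function of u and a function of v, the common
shape of both parts that the orthogonality argument uses. *)
Definition cross_im (u v : R * R) : R := u.2 * v.1 + u.1 * - v.2.

Lemma cross_sqnorm u v : cross_re u v ^+ 2 + cross_im u v ^+ 2 = sqnorm u * sqnorm v.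
Proof. rewrite /cross_re /cross_im /sqnorm; ring. Qed.

Lemma to_complex_conj u v :
  to_complex u * ((to_complex v)^*)%C = (cross_re u v +i* cross_im u v)%C.
Proof.
apply/eqP; rewrite eq_complex /cross_re /cross_im /=.
by apply/andP; split; apply/eqP; ring.
Qed.

Lemma sum_complex (I : finType) (a b : I -> R) :
  \sum_k (a k +i* b k)%C = ((\sum_k a k) +i* (\sum_k b k))%C.
Proof. by elim/big_rec3: _ => // k u v c _ ->. Qed.

Lemma gram_error_offdiag i j : i != j ->
  gram_error z i j = (\sum_k cross_re (z i k) (z j k)) ^+ 2 +
                     (\sum_k cross_im (z i k) (z j k)) ^+ 2.
Proof.
move=> /negbTE ij; rewrite /gram_error ij mulr0n subr0 sqr_normcE /gram.
under eq_bigr do rewrite to_complex_conj.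
by rewrite sum_complex.
Qed.

Lemma gram_error_diag i :
  gram_error z i i = (\sum_k (sqnorm (z i k) - 1)) ^+ 2.
Proof.
rewrite /gram_error eqxx mulr1n sqr_normcE /gram.
under eq_bigr do rewrite to_complex_conj.
rewrite sum_complex /= subr0.
have -> : \sum_k cross_im (z i k) (z i k) = 0.
  by apply: big1 => k _; rewrite /cross_im; ring.
rewrite [0 ^+ 2]expr0n addr0; congr (_ ^+ 2); rewrite sumrB sumr_const card_ord.
by congr (_ - _); apply: eq_bigr => k _; rewrite /cross_re /sqnorm !expr2.
Qed.

Lemma gram_error_ge0 i j : 0 <= gram_error z i j.
Proof. exact: sqr_ge0. Qed.
End GramErrorFormula.

Section GramErrorMean.
Context d (Om : measurableType d) (R : realType) (P : probability Om R).
Variable nu : probability (R * R)%type R.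
Hypothesis nu_moments : all_moments_finite nu.
Hypothesis nu_mean : complex_mean nu = 0.
Hypothesis nu_var : complex_variance nu = 1%E.
Variables (T S : nat) (Z : 'I_T * 'I_S -> {RV P >-> (R * R)%type}).
Hypothesis hZ : iid Z nu.

Let indep : mutually_independent Z := hZ.1.
Let law q : has_law (Z q) nu := hZ.2 q.

Lemma measurable_coordinate (f : R * R -> R) q : measurable_fun [set: R * R] f ->
  measurable_fun [set: Om] (fun w => f (Z q w)).
Proof. by move=> mf; apply: measurableT_comp => //; exact: measurable_funP. Qed.

Lemma others_measurable_coordinate (f : R * R -> R) p q : measurable_fun [set: R * R] f ->
  q != p -> generated_measurable (others Z p) (fun w => f (Z q w)).
Proof.
move=> mf qp; apply: (measurableT_comp mf).
apply: generated_measurable_mem => B hB; by exists q.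
Qed.

(** The source of all the cancellations: a centered function of one entry is
orthogonal to any integrable function of the other entries. *)
Lemma integral_centered_times_others (f : R * R -> R) p (V : Om -> R) :
  nu.-integrable [set: R * R] (EFin \o f) -> (\int[nu]_z (f z)%:E = 0)%E ->
  generated_measurable (others Z p) V -> P.-integrable [set: Om] (EFin \o V) ->
  P.-integrable [set: Om] (fun w => (f (Z p w) * V w)%:E) /\
  (\int[P]_w (f (Z p w) * V w)%:E = 0)%E.
Proof.
move=> fi f0 gV iV.
have mf : measurable_fun [set: R * R] f by apply/measurable_EFinP; case/integrableP : fi.
have ind : independent_functions P (f \o Z p) V.
  exact: independent_functions_one_others.
have mfZ : measurable_fun [set: Om] (f \o Z p) by exact: measurable_coordinate.
have mV : measurable_fun [set: Om] V by apply/measurable_EFinP; case/integrableP : iV.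
have ifZ : P.-integrable [set: Om] (EFin \o (f \o Z p)).
  exact: (integrable_law (law p)).
split; first exact: (integrable_independentM mfZ mV ind).
rewrite (integral_independentM mfZ mV ind)//.
by rewrite (integral_law (law p) fi) f0 mul0e.
Qed.

(** For two distinct rows i and j, the k-th term of the real or imaginary part of
their inner product is a sum of two products of a coordinate of Z (i, k) by a
coordinate of Z (j, k), up to sign. *)
Section Bilinear.
Variables (f1 f2 g1 g2 : R * R -> R).
Hypotheses (mf1 : measurable_fun [set: R * R] f1) (mf2 : measurable_fun [set: R * R] f2).
Hypotheses (mg1 : measurable_fun [set: R * R] g1) (mg2 : measurable_fun [set: R * R] g2).
Hypotheses (bf1 : forall z, f1 z ^+ 2 <= sqnorm z) (bf2 : forall z, f2 z ^+ 2 <= sqnorm z).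
Hypotheses (bg1 : forall z, g1 z ^+ 2 <= sqnorm z) (bg2 : forall z, g2 z ^+ 2 <= sqnorm z).
Hypotheses (f10 : (\int[nu]_z (f1 z)%:E = 0)%E) (f20 : (\int[nu]_z (f2 z)%:E = 0)%E).
Variables i j : 'I_T.
Hypothesis ij : i != j.

Let U k w := f1 (Z (i, k) w) * g1 (Z (j, k) w) + f2 (Z (i, k) w) * g2 (Z (j, k) w).

Let mU k : measurable_fun [set: Om] (U k).
Proof. by apply: measurable_funD; apply: measurable_funM; exact: measurable_coordinate. Qed.

Let isq q : P.-integrable [set: Om] (fun w => (sqnorm (Z q w) ^+ 2)%:E).
Proof.
apply: (integrable_law (law q) (f := fun z => sqnorm z ^+ 2)).
exact: integrable_sqnorm_sqr.
Qed.

Lemma bilinear_square_integrable k : square_integrable P (U k).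
Proof.
apply: (square_integrable_le
  (V := fun w => 2 * (sqnorm (Z (i, k) w) ^+ 2 + sqnorm (Z (j, k) w) ^+ 2))) => //.
  move=> w; rewrite /U.
  set u := Z (i, k) w; set v := Z (j, k) w.
  have h1 : f1 u ^+ 2 * g1 v ^+ 2 <= sqnorm u * sqnorm v by rewrite ler_pM ?sqr_ge0.
  have h2 : f2 u ^+ 2 * g2 v ^+ 2 <= sqnorm u * sqnorm v by rewrite ler_pM ?sqr_ge0.
  have h3 := sqr_ge0 (f1 u * g1 v - f2 u * g2 v).
  have h4 := sqr_ge0 (sqnorm u - sqnorm v).
  rewrite sqrrB !exprMn mulr2n in h3; rewrite sqrrB mulr2n in h4.
  rewrite sqrrD !exprMn mulr2n; lra.
apply: (integrableZl measurableT 2 (f := fun w => (sqnorm (Z (i, k) w) ^+ 2 + sqnorm (Z (j, k) w) ^+ 2)%:E)).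
by apply: integrableD_fin; exact: isq.
Qed.

Let sg (g : R * R -> R) q : measurable_fun [set: R * R] g ->
  (forall z, g z ^+ 2 <= sqnorm z) -> square_integrable P (fun w => g (Z q w)).
Proof.
move=> mg bg; apply: (square_integrable_le (V := fun w => sqnorm (Z q w))) => //.
  exact: measurable_coordinate.
apply: (integrable_law (law q) (f := @sqnorm R)).
exact: integrable_sqnorm.
Qed.

(** In U k * U l the coordinates of Z (i, k) appear linearly, and the other factors
involve only the entries (j, k), (i, l) and (j, l), all different from (i, k)
because i != j and k != l. *)
Lemma bilinear_orthogonal k l : k != l -> (\int[P]_w (U k w * U l w)%:E = 0)%E.
Proof.
move=> kl.
have term (f g : R * R -> R) : measurable_fun [set: R * R] f -> measurable_fun [set: R * R] g ->
    (forall z, f z ^+ 2 <= sqnorm z) -> (forall z, g z ^+ 2 <= sqnorm z) ->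
    (\int[nu]_z (f z)%:E = 0)%E ->
    P.-integrable [set: Om] (fun w => (f (Z (i, k) w) * (g (Z (j, k) w) * U l w))%:E) /\
    (\int[P]_w (f (Z (i, k) w) * (g (Z (j, k) w) * U l w))%:E = 0)%E.
  move=> mf mg bf bg f0; apply: integral_centered_times_others => //.
  - exact: integrable_coordinate.
  - have ne1 : (j, k) != (i, k) by rewrite xpair_eqE eq_sym (negbTE ij).
    have ne2 : (j, l) != (i, k) by rewrite xpair_eqE eq_sym (negbTE ij).
    have ne3 : (i, l) != (i, k) by rewrite xpair_eqE eqxx eq_sym.
    apply: measurable_funM; first exact: others_measurable_coordinate.
    by apply: measurable_funD; apply: measurable_funM; exact: others_measurable_coordinate.
  - by apply: square_integrableM; [exact: sg|exact: bilinear_square_integrable].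
have [i1 z1] := term f1 g1 mf1 mg1 bf1 bg1 f10.
have [i2 z2] := term f2 g2 mf2 mg2 bf2 bg2 f20.
transitivity (\int[P]_w ((f1 (Z (i, k) w) * (g1 (Z (j, k) w) * U l w))%:E +
   (f2 (Z (i, k) w) * (g2 (Z (j, k) w) * U l w))%:E))%E.
  by apply: eq_integral => w _; rewrite -EFinD {1}/U mulrDl !mulrA.
by rewrite integralD// z1 z2 adde0.
Qed.
End Bilinear.

(** By orthogonality only the diagonal terms remain; each is the mean of
|Z (i, k)|^2 |Z (j, k)|^2, a product of two independent variables of mean 1. *)
Lemma integral_gram_error_offdiag i j : i != j ->
  (\int[P]_w (gram_error (fun i j => Z (i, j) w) i j)%:E = (S%:R)%:E)%E.
Proof.
move=> ij.
have m1 := @measurable_fst _ _ (measurableTypeR R) (measurableTypeR R).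
have m2 := @measurable_snd _ _ (measurableTypeR R) (measurableTypeR R).
have m2' : measurable_fun [set: R * R] (fun z : R * R => - z.2) by apply: measurableT_comp.
have b1 (z : R * R) : z.1 ^+ 2 <= sqnorm z by rewrite lerDl sqr_ge0.
have b2 (z : R * R) : z.2 ^+ 2 <= sqnorm z by rewrite lerDr sqr_ge0.
have b2' (z : R * R) : (- z.2) ^+ 2 <= sqnorm z by rewrite sqrrN b2.
have e1 := integral_fst_eq0 nu_mean nu_var.
have e2 := integral_snd_eq0 nu_mean nu_var.
have reS k : square_integrable P (fun w => cross_re (Z (i, k) w) (Z (j, k) w)).
  exact: (bilinear_square_integrable m1 m2 m1 m2).
have imS k : square_integrable P (fun w => cross_im (Z (i, k) w) (Z (j, k) w)).
  exact: (bilinear_square_integrable m2 m1 m1 m2').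
have reO k l : k != l -> (\int[P]_w (cross_re (Z (i, k) w) (Z (j, k) w) *
    cross_re (Z (i, l) w) (Z (j, l) w))%:E = 0)%E.
  exact: (bilinear_orthogonal m1 m2 m1 m2).
have imO k l : k != l -> (\int[P]_w (cross_im (Z (i, k) w) (Z (j, k) w) *
    cross_im (Z (i, l) w) (Z (j, l) w))%:E = 0)%E.
  exact: (bilinear_orthogonal m2 m1 m1 m2').
under eq_integral do rewrite gram_error_offdiag// EFinD.
have mre k : measurable_fun [set: Om] (fun w => cross_re (Z (i, k) w) (Z (j, k) w)) := (reS k).1.
have mim k : measurable_fun [set: Om] (fun w => cross_im (Z (i, k) w) (Z (j, k) w)) := (imS k).1.
rewrite ge0_integralD//; last 4 first.
- by move=> w _; rewrite lee_fin sqr_ge0.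
- by apply/measurable_EFinP; apply: measurable_funX; apply: measurable_sum.
- by move=> w _; rewrite lee_fin sqr_ge0.
- by apply/measurable_EFinP; apply: measurable_funX; apply: measurable_sum.
rewrite (integral_sqr_sum_orthogonal reS reO) (integral_sqr_sum_orthogonal imS imO).
rewrite -big_split /=.
rewrite (eq_bigr (fun=> 1%E)); last first.
  move=> k _; rewrite -ge0_integralD//; last 4 first.
  - by move=> w _; rewrite lee_fin sqr_ge0.
  - by apply/measurable_EFinP; apply: measurable_funX; exact: mre.
  - by move=> w _; rewrite lee_fin sqr_ge0.
  - by apply/measurable_EFinP; apply: measurable_funX; exact: mim.
  transitivity (\int[P]_w ((sqnorm (Z (i, k) w))%:E * (sqnorm (Z (j, k) w))%:E))%E.
    by apply: eq_integral => w _; rewrite -EFinD -EFinM -cross_sqnorm.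
  have mq q : measurable_fun [set: Om] (fun w => sqnorm (Z q w)).
    exact: (measurable_coordinate q (@measurable_sqnorm R)).
  have ne : (j, k) != (i, k) by rewrite xpair_eqE eq_sym (negbTE ij).
  have ind : independent_functions P (fun w => sqnorm (Z (i, k) w)) (fun w => sqnorm (Z (j, k) w)).
    apply: (independent_functions_one_others indep (f := @sqnorm R)).
      exact: measurable_sqnorm.
    by apply: others_measurable_coordinate => //; exact: measurable_sqnorm.
  under eq_integral do rewrite -EFinM.
  rewrite nonneg_integral_independentM//; try by move=> w; exact: sqnorm_ge0.
  have s1 q : (\int[P]_w (sqnorm (Z q w))%:E = 1)%E.
    rewrite (ge0_integral_law (law q) (f := fun z => (sqnorm z)%:E)).
    - exact: integral_sqnorm.
    - by apply/measurable_EFinP; exact: measurable_sqnorm.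
    - by move=> z; rewrite lee_fin sqnorm_ge0.
  by rewrite !s1 mule1.
by rewrite sumEFin sumr_const card_ord.
Qed.

Lemma integral_gram_error_diag i :
  (\int[P]_w (gram_error (fun i j => Z (i, j) w) i i)%:E
     = (S%:R)%:E * sqnorm_variance nu)%E.
Proof.
pose f (z : R * R) := sqnorm z - 1.
have mf : measurable_fun [set: R * R] f.
  by apply: measurable_funB => //; exact: measurable_sqnorm.
have isf : nu.-integrable [set: R * R] (fun z => (f z ^+ 2)%:E).
  exact: integrable_sqnorm_centered_sqr.
have i1 : nu.-integrable [set: R * R] (fun=> (-1)%:E) by exact: finite_measure_integrable_cst.
have is1 := integrable_sqnorm nu_mean nu_var.
have ifi : nu.-integrable [set: R * R] (EFin \o f) by exact: integrableD_fin.
have f0 : (\int[nu]_z (f z)%:E = 0)%E.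
  rewrite /f; under eq_integral do rewrite EFinD.
  rewrite integralD// integral_sqnorm//.
  rewrite (@integral_cst _ _ _ nu _ measurableT) [X in (_ + _ * X)%E](_ : _ = 1%E).
    by rewrite mule1 -EFinD subrr.
  exact: (probability_setT nu).
have sq k : square_integrable P (fun w => f (Z (i, k) w)).
  split; first exact: measurable_coordinate.
  exact: (integrable_law (law (i, k)) (f := fun z => f z ^+ 2)).
have oq k l : k != l -> (\int[P]_w (f (Z (i, k) w) * f (Z (i, l) w))%:E = 0)%E.
  move=> kl; apply: (integral_centered_times_others ifi f0 _ _).2.
    apply: others_measurable_coordinate => //.
    by rewrite xpair_eqE eqxx eq_sym.
  exact: (integrable_law (law (i, l))).
under eq_integral do rewrite gram_error_diag.
rewrite (integral_sqr_sum_orthogonal sq oq).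
rewrite (eq_bigr (fun=> sqnorm_variance nu)); last first.
  move=> k _; rewrite (integral_law (law (i, k)) isf)//.
have /fineK <- : sqnorm_variance nu \is a fin_num.
  exact: sqnorm_variance_fin_num.
by rewrite sumEFin sumr_const card_ord -EFinM mulr_natl.
Qed.
End GramErrorMean.

(** * The Frobenius norm of the perturbation *)

Lemma finite_union_bound d (Om : measurableType d) (R : realType)
    (P : {measure set Om -> \bar R}) (I : finType) (A : I -> set Om) :
  (forall i, measurable (A i)) -> (P (\big[setU/set0]_i A i) <= \sum_i P (A i))%E.
Proof.
move=> mA.
suff : measurable (\big[setU/set0]_i A i) /\ (P (\big[setU/set0]_i A i) <= \sum_i P (A i))%E.
  by case.
apply: (big_rec2 (fun B x => measurable B /\ (P B <= x)%E)).
  by rewrite measure0.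
move=> i B x _ [mB PB]; split; first exact: measurableU.
by apply: (le_trans (measureU2 P (mA i) mB)); exact: leeD.
Qed.

Section PerturbationTail.
Context d (Om : measurableType d) (R : realType) (P : probability Om R).
Variable nu : probability (R * R)%type R.
Hypothesis nu_moments : all_moments_finite nu.
Hypothesis nu_mean : complex_mean nu = 0.
Hypothesis nu_var : complex_variance nu = 1%E.
Variable mu : probability R R.
Variables (T S : nat) (Z : 'I_T * 'I_S -> {RV P >-> (R * R)%type}).
Variable sigma : 'I_T -> {RV P >-> R}.
Hypothesis hZ : iid Z nu.
Hypothesis hsigma : iid sigma mu.
Hypothesis hindep : independent_families sigma Z.

Let err i j w := gram_error (fun i j => Z (i, j) w) i j.

Let err0 i j w : 0 <= err i j w.
Proof. exact: gram_error_ge0. Qed.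

Lemma generated_measurable_gram_error (G : set (set Om)) :
  (forall q, generated_measurable G (Z q)) ->
  forall i j, generated_measurable G (err i j).
Proof.
move=> mZ i j.
have m1 q : generated_measurable G (fun w => (Z q w).1).
  by apply: measurableT_comp (mZ q); exact: measurable_fst.
have m2 q : generated_measurable G (fun w => (Z q w).2).
  by apply: measurableT_comp (mZ q); exact: measurable_snd.
have [ij|ij] := eqVneq i j; rewrite /err /generated_measurable; last first.
  under eq_fun do rewrite gram_error_offdiag//.
  have m2N q : generated_measurable G (fun w => - (Z q w).2).
    by apply: measurableT_comp => //; exact: m2.
  apply: measurable_funD; apply: measurable_funX; apply: measurable_sum => k;
    apply: measurable_funD; apply: measurable_funM;
    by [exact: m1|exact: m2|exact: m2N].
rewrite -ij; under eq_fun do rewrite gram_error_diag.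
apply: measurable_funX; apply: measurable_sum => k.
apply: measurable_funB => //; apply: measurable_funD; apply: measurable_funX.
  exact: m1.
exact: m2.
Qed.

Let rvs_measurable (I : Type) d' (E : measurableType d') (X : I -> {RV P >-> E}) :
  \bigcup_i preimage_set_system [set: Om] (X i) measurable `<=` measurable.
Proof. by move=> _ [j _ [B mB <-]]; rewrite setTI; exact: measurable_preimage. Qed.

Let family_mem (I : Type) d' (E : measurableType d') (X : I -> {RV P >-> E}) i :
  generated_measurable (\bigcup_i preimage_set_system [set: Om] (X i) measurable) (X i).
Proof. by apply: generated_measurable_mem => B hB; exists i. Qed.

Lemma measurable_gram_error i j : measurable_fun [set: Om] (err i j).
Proof.
apply: (generated_measurable_sub (@rvs_measurable _ _ _ Z)).
by apply: generated_measurable_gram_error => q; exact: family_mem.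
Qed.

Variable u : R.
Hypothesis u0 : 0 < u.
(** The squares are truncated at u, which gives them moments whatever their tail is. *)
Let tau i w := truncated_square u (sigma i w).

Let tau0 i w : 0 <= tau i w.
Proof. by apply: truncated_square_ge0; exact: ltW. Qed.

Let mtau i : measurable_fun [set: Om] (tau i).
Proof.
by apply: (measurableT_comp (measurable_truncated_square u)); exact: measurable_funP.
Qed.

Variable M : R.
Hypothesis hM : (\int[mu]_s (truncated_square u s)%:E <= M%:E)%E.

Let M0 : 0 <= M.
Proof.
rewrite -lee_fin; apply: le_trans hM; apply: integral_ge0 => s _.
by rewrite lee_fin truncated_square_ge0// ltW.
Qed.

Let mean_tau i : (\int[P]_w (tau i w)%:E <= M%:E)%E.
Proof.
rewrite (ge0_integral_law (hsigma.2 i) (f := fun s => (truncated_square u s)%:E))//.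
  by apply/measurable_EFinP; exact: measurable_truncated_square.
by move=> s; rewrite lee_fin truncated_square_ge0// ltW.
Qed.

Let mean_tau_offdiag i j : i != j -> (\int[P]_w (tau i w * tau j w)%:E <= (M ^+ 2)%:E)%E.
Proof.
move=> ij; rewrite nonneg_integral_independentM//; last first.
  apply: (independent_functions_one_others hsigma.1 (f := truncated_square u)).
    exact: measurable_truncated_square.
  apply: (measurableT_comp (measurable_truncated_square u)).
  by apply: generated_measurable_mem => B hB; exists j => //=; rewrite eq_sym.
by rewrite expr2 EFinM lee_pmul// integral_ge0// => w _; rewrite lee_fin tau0.
Qed.

(** On the diagonal min(s^2, u)^2 <= u min(s^2, u): the second moment of the truncated
square costs only a factor u. *)
Let mean_tau_diag i : (\int[P]_w (tau i w * tau i w)%:E <= (u * M)%:E)%E.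
Proof.
apply: (@le_trans _ _ (\int[P]_w (u%:E * (tau i w)%:E))%E).
  apply: ge0_le_integral => //.
  - by move=> w _; rewrite lee_fin mulr_ge0.
  - by apply/measurable_EFinP; apply: measurable_funM.
  - by apply: measurable_funeM; apply/measurable_EFinP.
  - by move=> w _; rewrite -EFinM lee_fin ler_wpM2r// ge_min lexx orbT.
rewrite ge0_integralZl//; last 3 first.
- exact/measurable_EFinP.
- by move=> w _; rewrite lee_fin.
- by rewrite lee_fin ltW.
by rewrite EFinM lee_wpmul2l// lee_fin ltW.
Qed.

Let kappa : R := fine (sqnorm_variance nu).

Let kappa0 : 0 <= kappa.
Proof. by apply: fine_ge0; apply: integral_ge0 => z _; rewrite lee_fin sqr_ge0. Qed.

Let Q w := \sum_i \sum_j tau i w * tau j w * err i j w.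

Let mQ : measurable_fun [set: Om] Q.
Proof.
apply: measurable_sum => i; apply: measurable_sum => j.
by apply: measurable_funM; [exact: measurable_funM|exact: measurable_gram_error].
Qed.

Let Q0 w : 0 <= Q w.
Proof.
by apply: sumr_ge0 => i _; apply: sumr_ge0 => j _; apply: mulr_ge0 => //; exact: mulr_ge0.
Qed.

Let mean_term i j : (\int[P]_w (tau i w * tau j w * err i j w)%:E =
  \int[P]_w (tau i w * tau j w)%:E * \int[P]_w (err i j w)%:E)%E.
Proof.
rewrite (nonneg_integral_independentM (X := fun w => tau i w * tau j w) (Y := err i j))//.
- exact: measurable_funM.
- exact: measurable_gram_error.
- apply: (independent_functions_generated hindep).
    by apply: measurable_funM; apply: (measurableT_comp (measurable_truncated_square u));
      exact: family_mem.
  by apply: generated_measurable_gram_error => q; exact: family_mem.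
- by move=> w; rewrite mulr_ge0.
Qed.

Lemma mean_truncated_error : (\int[P]_w (Q w)%:E <=
  ((T%:R * M) ^+ 2 * S%:R + T%:R * S%:R * kappa * (u * M))%:E)%E.
Proof.
have term0 i j w : 0 <= tau i w * tau j w * err i j w.
  by apply: mulr_ge0 => //; exact: mulr_ge0.
have mterm i j : measurable_fun [set: Om] (fun w => tau i w * tau j w * err i j w).
  by apply: measurable_funM; [exact: measurable_funM|exact: measurable_gram_error].
rewrite /Q; under eq_integral do rewrite -sumEFin.
rewrite ge0_integral_sum//; last 2 first.
- by move=> i; apply/measurable_EFinP; apply: measurable_sum.
- by move=> i w _; rewrite lee_fin sumr_ge0.
apply: (@le_trans _ _ (\sum_(i < T) \sum_(j < T)
    (M ^+ 2 * S%:R + (if j == i then S%:R * kappa * (u * M) else 0))%:E)%E).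
  apply: lee_sum => i _; under eq_integral do rewrite -sumEFin.
  rewrite ge0_integral_sum//; last 2 first.
  - by move=> j; exact/measurable_EFinP.
  - by move=> j w _; rewrite lee_fin.
  apply: lee_sum => j _; rewrite mean_term.
  have [->|ji] := eqVneq j i.
    rewrite (integral_gram_error_diag nu_moments nu_mean nu_var hZ).
    rewrite -/kappa -[sqnorm_variance nu]fineK; last first.
      exact: sqnorm_variance_fin_num.
    rewrite -/kappa -EFinM muleC.
    apply: (@le_trans _ _ ((S%:R * kappa)%:E * (u * M)%:E)%E).
      by rewrite lee_wpmul2l// lee_fin mulr_ge0.
    by rewrite -EFinM lee_fin lerDr mulr_ge0// sqr_ge0.
  rewrite addr0 (integral_gram_error_offdiag nu_moments nu_mean nu_var hZ) 1?eq_sym//.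
  by rewrite EFinM lee_wpmul2r// mean_tau_offdiag// eq_sym.
rewrite (eq_bigr (fun=> (T%:R * (M ^+ 2 * S%:R) + S%:R * kappa * (u * M))%:E)); last first.
  move=> i _; rewrite sumEFin; congr (_%:E); rewrite big_split /=.
  by rewrite sumr_const card_ord -big_mkcond big_pred1_eq [T%:R * _]mulr_natl.
rewrite sumEFin sumr_const card_ord lee_fin -mulr_natl.
rewrite le_eqVlt; apply/orP; left; apply/eqP; ring.
Qed.

Let measurable_error_gt c :
  measurable [set w | c < \sum_i \sum_j sigma i w ^+ 2 * sigma j w ^+ 2 * err i j w].
Proof.
have mf : measurable_fun [set: Om]
    (fun w => \sum_i \sum_j sigma i w ^+ 2 * sigma j w ^+ 2 * err i j w).
  apply: measurable_sum => i; apply: measurable_sum => j.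
  apply: measurable_funM; last exact: measurable_gram_error.
  by apply: measurable_funM; apply: measurable_funX; exact: measurable_funP.
have := mf measurableT _ (measurable_itv `]c, +oo[%R); rewrite setTI.
by congr measurable; apply/seteqP; split => w /=; rewrite in_itv/= andbT.
Qed.

Lemma measurable_sigma_gt i : measurable [set w | u < sigma i w ^+ 2].
Proof. exact: (measurable_preimage (sigma i) (measurable_square_gt u)). Qed.

(** Either some square exceeds u, which the union bound controls, or the truncation
changes nothing and the Markov inequality applies to the truncated sum. *)
Lemma perturbation_tail (eps : R) : 0 < eps ->
  measurable [set w | eps ^+ 2 < \sum_i \sum_j sigma i w ^+ 2 * sigma j w ^+ 2 * err i j w] /\
  (P [set w | (eps ^+ 2 < \sum_i \sum_j sigma i w ^+ 2 * sigma j w ^+ 2 * err i j w)%R]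
  <= (T%:R * tail_of_square mu u +
      ((T%:R * M) ^+ 2 * S%:R + T%:R * S%:R * kappa * (u * M)) / eps ^+ 2)%:E)%E.
Proof.
move=> eps0; split => //.
pose A i := [set w | u < sigma i w ^+ 2].
pose B := [set: Om] `&` [set w | ((eps ^+ 2)%:E <= `|(Q w)%:E|)%E].
have mB : measurable B.
  apply: emeasurable_fun_c_infty => //; apply: measurableT_comp => //; exact/measurable_EFinP.
have mA : measurable (\big[setU/set0]_(i < T) A i).
  by apply: bigsetU_measurable => i _; exact: measurable_sigma_gt.
apply: (@le_trans _ _ (P (\big[setU/set0]_(i < T) A i `|` B))).
  rewrite le_measure ?inE//; first exact: measurableU.
  move=> w /= hw; have [[i hi]|hn] := pselect (exists i, u < sigma i w ^+ 2).
    by left; rewrite (bigD1 i)//=; left.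
  right; split => //=; rewrite lee_fin ger0_norm//.
  apply: ltW; apply: lt_le_trans hw _; rewrite /Q le_eqVlt; apply/orP; left; apply/eqP.
  apply: eq_bigr => i _; apply: eq_bigr => j _.
  have tauE k : sigma k w ^+ 2 = tau k w.
    rewrite /tau /truncated_square min_l// leNgt; apply/negP => hk; apply: hn.
    by exists k.
  by rewrite !tauE.
apply: (le_trans (measureU2 P mA mB)); rewrite EFinD; apply: leeD.
  apply: (le_trans (finite_union_bound P measurable_sigma_gt)).
  rewrite (eq_bigr (fun=> (tail_of_square mu u)%:E)); last first.
    move=> i _; rewrite -tail_of_squareE -(hsigma.2 i)//; exact: measurable_square_gt.
  by rewrite sumEFin sumr_const card_ord mulr_natl.
have e20 : 0 < eps ^+ 2 by rewrite exprn_gt0.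
rewrite EFinM muleC.
rewrite -(@lee_pmul2l _ (eps ^+ 2)%:E)//.
apply: le_trans (le_integral_abse P measurableT _ e20) _.
  exact/measurable_EFinP.
under eq_integral do rewrite gee0_abs ?lee_fin//.
apply: (le_trans mean_truncated_error).
by rewrite -!EFinM lee_fin mulVKf ?gt_eqF.
Qed.
End PerturbationTail.

(** * Measurability of the largest eigenvalue *)

Section MeasurableLambdaMax.
Context d (Om : measurableType d) (R : realType).

Definition measurable_complex (f : Om -> R[i]) :=
  measurable_fun [set: Om] (fun w => complex.Re (f w)) /\
  measurable_fun [set: Om] (fun w => complex.Im (f w)).

Lemma measurable_complex_cst (c : R[i]) : measurable_complex (fun=> c).
Proof. by split; exact: measurable_cst. Qed.

Lemma measurable_complexD f g : measurable_complex f -> measurable_complex g ->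
  measurable_complex (fun w => f w + g w).
Proof.
move=> [f1 f2] [g1 g2]; split.
  rewrite (_ : (fun w => _) = (fun w => complex.Re (f w) + complex.Re (g w))).
    exact: measurable_funD.
  by apply/funext => w; case: (f w); case: (g w).
rewrite (_ : (fun w => _) = (fun w => complex.Im (f w) + complex.Im (g w))).
  exact: measurable_funD.
by apply/funext => w; case: (f w); case: (g w).
Qed.

Lemma measurable_complexM f g : measurable_complex f -> measurable_complex g ->
  measurable_complex (fun w => f w * g w).
Proof.
move=> [f1 f2] [g1 g2]; split.
  rewrite (_ : (fun w => _) = (fun w => complex.Re (f w) * complex.Re (g w) -
      complex.Im (f w) * complex.Im (g w))).
    by apply: measurable_funB; exact: measurable_funM.
  by apply/funext => w; case: (f w) => ? ?; case: (g w).
rewrite (_ : (fun w => _) = (fun w => complex.Re (f w) * complex.Im (g w) +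
    complex.Im (f w) * complex.Re (g w))).
  by apply: measurable_funD; exact: measurable_funM.
by apply/funext => w; case: (f w) => ? ?; case: (g w).
Qed.

Lemma measurable_complex_sum (I : finType) (f : I -> Om -> R[i]) :
  (forall i, measurable_complex (f i)) -> measurable_complex (fun w => \sum_i f i w).
Proof.
move=> mf; elim: (index_enum I) => [|i r IH].
  by under eq_fun do rewrite big_nil; exact: measurable_complex_cst.
by under eq_fun do rewrite big_cons; exact: measurable_complexD.
Qed.

Lemma measurable_complex_mulmx m n p (A : Om -> 'M[R[i]]_(m, n)) (B : Om -> 'M[R[i]]_(n, p)) :
  (forall i j, measurable_complex (fun w => A w i j)) ->
  (forall i j, measurable_complex (fun w => B w i j)) ->
  forall i j, measurable_complex (fun w => (A w *m B w) i j).
Proof.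
move=> mA mB i j; rewrite (_ : (fun w => _) = (fun w => \sum_k A w i k * B w k j)).
  by apply: measurable_complex_sum => k; exact: measurable_complexM.
by apply/funext => w; rewrite mxE.
Qed.

Lemma measurable_complex_expmx n (A : Om -> 'M[R[i]]_n) k :
  (forall i j, measurable_complex (fun w => A w i j)) ->
  forall i j, measurable_complex (fun w => (A w ^+ k) i j).
Proof.
move=> mA; elim: k => [|k IH] i j.
  by under eq_fun do rewrite expr0; exact: measurable_complex_cst.
under eq_fun do rewrite exprS -mulmxE.
exact: measurable_complex_mulmx.
Qed.

Lemma measurable_normc_le (f : Om -> R[i]) (c : R) : 0 <= c -> measurable_complex f ->
  measurable [set w | Normc.normc (f w) <= c].
Proof.
move=> c0 [f1 f2].
rewrite (_ : [set w | _] = [set w | complex.Re (f w) ^+ 2 + complex.Im (f w) ^+ 2 <= c ^+ 2]).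
  have mf : measurable_fun [set: Om] (fun w => complex.Re (f w) ^+ 2 + complex.Im (f w) ^+ 2).
    by apply: measurable_funD; apply: measurable_funX.
  have := mf measurableT _ (measurable_itv `]-oo, (c ^+ 2)%R]%R); rewrite setTI.
  by congr measurable; apply/seteqP; split => w /=; rewrite in_itv.
by apply/seteqP; split => w /=; rewrite -sqr_normcE ler_pXn2r ?nnegrE ?normc_ge0.
Qed.

Lemma measurable_fun_of_le_sets (f : Om -> R) :
  (forall x, measurable [set w | f w <= x]) -> measurable_fun [set: Om] f.
Proof.
move=> mf; apply: (measurability _ (RGenOInfty.measurableE R)) => //.
move=> _ [_ [x ->] <-]; rewrite setTI.
rewrite (_ : _ @^-1` _ = ~` [set w | f w <= x]); first exact: measurableC.
by apply/seteqP; split => w /=; rewrite in_itv/= andbT ltNge => /negP.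
Qed.

(** The sublevel sets are countable intersections of conditions on traces of even
powers, by [lambda_max_le_trace]; below level 0 they are empty. *)
Lemma measurable_lambda_max n (H : Om -> 'M[R[i]]_n) :
  (forall i j, measurable_complex (fun w => H w i j)) ->
  (forall w, adjoint (H w) = H w) ->
  measurable_fun [set: Om] (fun w => lambda_max (H w)).
Proof.
move=> mH hH; apply: measurable_fun_of_le_sets => x.
have [x0|x0] := ltP x 0.
  rewrite (_ : [set w | _] = set0)//; apply/seteqP; split => // w /=.
  by rewrite leNgt (lt_le_trans x0 (lambda_max_ge0 _)).
rewrite (_ : [set w | _] =
    \bigcap_m [set w | Normc.normc (\tr (H w ^+ m.*2)) <= n%:R * x ^+ m.*2]).
  apply: bigcapT_measurable => m; apply: measurable_normc_le.
    by rewrite mulr_ge0// exprn_ge0.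
  apply: measurable_complex_sum => i; exact: measurable_complex_expmx.
apply/seteqP; split => w /= h.
  by move=> m _; exact: (lambda_max_le_trace (hH w) x0).1 h m.
by apply: (lambda_max_le_trace (hH w) x0).2 => m; exact: h.
Qed.

Lemma measurable_lambda_max_scaled_gram (T S : nat) (s : 'I_T -> Om -> R)
    (z : 'I_T -> 'I_S -> Om -> R * R) :
  (forall i, measurable_fun [set: Om] (s i)) ->
  (forall i j, measurable_fun [set: Om] (z i j)) ->
  measurable_fun [set: Om]
    (fun w => lambda_max (scaled_gram (fun i => s i w) (fun i j => z i j w))).
Proof.
move=> ms mz; apply: measurable_lambda_max => [i j|w]; last exact: scaled_gram_hermitian.
under eq_fun do rewrite scaled_gramE.
apply: measurable_complexM.
  split => /=; last exact: measurable_cst.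
  exact: measurable_funM.
apply: measurable_complex_sum => k.
have mz1 i' : measurable_fun [set: Om] (fun w => (z i' k w).1).
  by apply: measurableT_comp => //; exact: measurable_fst.
have mz2 i' : measurable_fun [set: Om] (fun w => (z i' k w).2).
  by apply: measurableT_comp => //; exact: measurable_snd.
apply: measurable_complexM; split => //=.
exact: measurableT_comp.
Qed.

End MeasurableLambdaMax.

(** * Comparison with the maximum of independent variables *)

Section OneSample.
Context d (Om : measurableType d) (R : realType) (P : probability Om R).
Variable nu : probability (R * R)%type R.
Hypothesis nu_moments : all_moments_finite nu.
Hypothesis nu_mean : complex_mean nu = 0.
Hypothesis nu_var : complex_variance nu = 1%E.
Variable mu : probability R R.
Variables (T S : nat) (Z : 'I_T * 'I_S -> {RV P >-> (R * R)%type}).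
Variable sigma : 'I_T -> {RV P >-> R}.
Hypothesis hZ : iid Z nu.
Hypothesis hsigma : iid sigma mu.
Hypothesis hindep : independent_families sigma Z.
Hypothesis S0 : (0 < S)%N.

Let G := tail_of_square mu.

Lemma prob_all_le t :
  P [set w | forall i, sigma i w ^+ 2 <= t] = ((1 - G t) ^+ T)%:E.
Proof.
have mA (i : 'I_T) : measurable [set s : R | s ^+ 2 <= t].
  rewrite (_ : [set s : R | _] = ~` [set s : R | t < s ^+ 2]).
    by apply: measurableC; exact: measurable_square_gt.
  by apply/seteqP; split => s /=; [move=> ?; apply/negP; rewrite -leNgt|move/negP; rewrite -leNgt].
have := hsigma.1 [set: 'I_T]%SET _ mA.
rewrite (_ : \bigcap_(i in _) _ = [set w | forall i, sigma i w ^+ 2 <= t]); last first.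
  apply/seteqP; split => w /= h i; last by move=> _; exact: h.
  by apply: h; rewrite /mkset; exact: finset.in_setT.
move=> ->; rewrite (eq_bigr (fun=> (1 - G t)%:E)).
  by rewrite prodEFin prodr_const cardsT card_ord.
by move=> i _; rewrite -cdf_of_squareE; exact: (hsigma.2 i _ (mA i)).
Qed.

Let lam w := lambda_max (scaled_gram (fun i => sigma i w) (fun i j => Z (i, j) w)).

Lemma measurable_sample_lambda_max : measurable_fun [set: Om] lam.
Proof.
apply: (measurable_lambda_max_scaled_gram (s := fun i => sigma i) (z := fun i j => Z (i, j))).
  by move=> i; exact: measurable_funP.
by move=> i j; exact: measurable_funP.
Qed.

Let mlam c : measurable [set w | lam w <= c].
Proof.
have := measurable_sample_lambda_max measurableT (measurable_itv `]-oo, c]%R); rewrite setTI.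
by congr measurable; apply/seteqP; split => w /=; rewrite in_itv.
Qed.

Variables (u M eps : R).
Hypothesis u0 : 0 < u.
Hypothesis eps0 : 0 < eps.
Hypothesis hM : (\int[mu]_s (truncated_square u s)%:E <= M%:E)%E.

(** The first term bounds the probability that the truncation at u acts, the second
one is the Markov bound at level eps^2 for the truncated Frobenius norm. *)
Definition perturbation_bound : R := T%:R * G u +
  ((T%:R * M) ^+ 2 * S%:R + T%:R * S%:R * fine (sqnorm_variance nu) * (u * M)) / eps ^+ 2.

Let bad := [set w | eps ^+ 2 < \sum_i \sum_j sigma i w ^+ 2 * sigma j w ^+ 2 *
  gram_error (fun i j => Z (i, j) w) i j].

Let mbad : measurable bad.
Proof. exact: (perturbation_tail nu_moments nu_mean nu_var hZ hsigma hindep u0 hM eps0).1. Qed.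

Let Pbad : (P bad <= perturbation_bound%:E)%E.
Proof. exact: (perturbation_tail nu_moments nu_mean nu_var hZ hsigma hindep u0 hM eps0).2. Qed.

Let mall t : measurable [set w | forall i, sigma i w ^+ 2 <= t].
Proof.
rewrite (_ : [set w | _] = \bigcap_(i in [set: 'I_T]) ~` [set w | t < sigma i w ^+ 2]).
  apply: fin_bigcap_measurable => [|i _]; first exact: finite_finset.
  exact/measurableC/measurable_sigma_gt.
apply/seteqP; split => w /= h i => [_|].
  by apply/negP; rewrite -leNgt.
by have := h i Logic.I => /negP; rewrite -leNgt.
Qed.

Lemma lambda_max_prob_le c :
  fine (P [set w | lam w <= c]) <= (1 - G ((c + eps) / S%:R)) ^+ T + perturbation_bound.
Proof.
rewrite -lee_fin fineK ?fin_num_measure// EFinD -prob_all_le.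
apply: (@le_trans _ _ (P ([set w | forall i, sigma i w ^+ 2 <= (c + eps) / S%:R] `|` bad))).
  rewrite le_measure ?inE//; first exact: measurableU.
  move=> w /= hw; have [|hb] := pselect (bad w); first by right.
  left => i; rewrite ler_pdivlMr ?ltr0n// mulrC.
  have := @scaled_gram_le_lambda_max _ _ _ (fun i => sigma i w) (fun i j => Z (i, j) w) eps (ltW eps0).
  move=> h; apply: (le_trans (h _ i)); last by rewrite lerD2r.
  by rewrite leNgt; apply/negP.
by apply: (le_trans (measureU2 P (mall _) mbad)); exact: leeD.
Qed.

Lemma lambda_max_prob_ge c : 0 <= c - eps ->
  (1 - G ((c - eps) / S%:R)) ^+ T <= fine (P [set w | lam w <= c]) + perturbation_bound.
Proof.
move=> ce; rewrite -lee_fin EFinD fineK ?fin_num_measure// -prob_all_le.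
apply: (@le_trans _ _ (P ([set w | lam w <= c] `|` bad))).
  rewrite le_measure ?inE//; first exact: measurableU.
  move=> w /= hw; have [|hb] := pselect (bad w); first by right.
  left; rewrite -[leRHS](subrK eps).
  apply: scaled_gram_lambda_max_le => //.
  - exact: ltW.
  - by rewrite leNgt; apply/negP.
  - by move=> i; rewrite mulrC -ler_pdivlMr ?ltr0n.
by apply: (le_trans (measureU2 P (mlam _) mbad)); exact: leeD.
Qed.
End OneSample.

(** * Passage to the limit *)

Definition frechet_cdf (R : realType) (b x : R) : R := expR (- x `^ (- b)).

Lemma frechet_cdf_small (R : realType) (b e : R) : 0 < b -> 0 < e ->
  exists2 v : R, 0 < v & frechet_cdf b v < e.
Proof.
(* At this level the value is exp (- 1 / e), which is less than e. *)
move=> b0 e0; exists (e `^ b^-1); first exact: powR_gt0.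
rewrite /frechet_cdf -powRrM mulrN mulVf ?gt_eqF// powR_inv1 ?ltW// expRN.
rewrite -[ltRHS]invrK ltf_pV2 ?posrE ?expR_gt0 ?invr_gt0//.
by rewrite (lt_le_trans _ (expR_ge1Dx _))// ltrDr.
Qed.

Lemma continuous_frechet_cdf (R : realType) (b x : R) : 0 < x ->
  {for x, continuous (frechet_cdf b)}.
Proof.
move=> x0; apply: (continuous_comp (f := fun x : R => - x `^ (- b)) (g := expR)).
  by apply: continuousN; exact: continuous_powR_gt0.
exact: continuous_expR.
Qed.

Lemma le_dist_of_near_bounds (R : realFieldType) (c lo up p e : R) :
  `|c - up| < e / 2 -> `|c - lo| < e / 2 -> lo - e / 2 <= p <= up + e / 2 ->
  `|c - p| <= e.
Proof.
rewrite !ltr_distlC => /andP[h1 h2] /andP[h3 h4] /andP[h5 h6].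
by rewrite ler_distlC; apply/andP; split; lra.
Qed.

Lemma bounds_of_perturbation (R : realFieldType) (lo up glo gup p bd e : R) :
  gup < up + e / 2 -> lo - e / 2 < glo -> bd < e / 2 ->
  p <= gup + bd -> glo <= p + bd -> lo - e <= p <= up + e.
Proof. by move=> h1 h2 h3 h4 h5; apply/andP; split; lra. Qed.

Section Limit.
Variables (R : realType) (mu : probability R R) (b L : R).
Hypothesis b02 : 0 < b < 2.
Hypothesis L0 : 0 < L.
Hypothesis GL : tail_of_square mu t * t `^ b @[t --> +oo] --> L.
Variables (T S : nat -> nat) (y : R).
Hypothesis hT : T n @[n --> \oo] --> \oo.
Hypothesis hS : S n @[n --> \oo] --> \oo.
Hypothesis hTS : (T n)%:R / (S n)%:R @[n --> \oo] --> y.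
Variable nu : probability (R * R)%type R.
Hypothesis nu_moments : all_moments_finite nu.
Hypothesis nu_mean : complex_mean nu = 0.
Hypothesis nu_var : complex_variance nu = 1%E.
Variables (d : nat -> measure_display) (Om : forall n, measurableType (d n)).
Variable P : forall n, probability (Om n) R.
Variable sigma : forall n, 'I_(T n) -> {RV (P n) >-> R}.
Variable Z : forall n, 'I_(T n) * 'I_(S n) -> {RV (P n) >-> (R * R)%type}.
Hypothesis hsigma : forall n, iid (@sigma n) mu.
Hypothesis hZ : forall n, iid (@Z n) nu.
Hypothesis hindep : forall n, independent_families (@sigma n) (@Z n).
Variable a : nat -> R.
Hypothesis ha : forall n, (0 < T n)%N -> tail_of_square mu (a n) = (T n)%:R^-1.

Let G := tail_of_square mu.
Let b0 : 0 < b. Proof. by case/andP : b02. Qed.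
Let G1 : forall t, G t <= 1 := tail_of_square_le1 mu.
Let Gdec : forall s t, s <= t -> G t <= G s := @tail_of_square_nonincreasing _ mu.
Let ay : a n @[n --> \oo] --> +oo := quantile_cvgy L0 Gdec GL hT ha.

(** The exponent g of the tail bound: g + g > b makes T a^(-2g) vanish, g < 1 makes
the truncated mean converge geometrically, and g <= b makes the tail bound hold.
The three are compatible because b < 2. *)
Let intermediate_exponent : exists g : R, [/\ b < g + g, 0 < g < 1 & g <= b].
Proof.
have /andP[_ b2] := b02; have b0' := b0.
have m1 : Num.min 1 b <= 1 by rewrite ge_min lexx.
have mb : Num.min 1 b <= b by rewrite ge_min lexx orbT.
have bm : b / 2 < Num.min 1 b by rewrite lt_min; apply/andP; split; lra.
by exists ((b / 2 + Num.min 1 b) / 2); split; [lra|apply/andP; split; lra|lra].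
Qed.

(** With the truncation level K a n and a perturbation of relative size eta, only the
probability that the truncation acts survives in the limit. *)
Lemma perturbation_vanishes eta K : 0 < eta -> 0 < K ->
  exists Mn : nat -> R,
   (forall n, 0 < a n -> (\int[mu]_s (truncated_square (K * a n) s)%:E <= (Mn n)%:E)%E) /\
   perturbation_bound nu mu (T n) (S n) (K * a n) (Mn n) (eta * ((S n)%:R * a n))
     @[n --> \oo] --> K `^ (- b).
Proof.
move=> eta0 K0; have [g [bgg /andP[g0 g1] gb]] := intermediate_exponent.
have [C C0 HC] := regular_tail_le_powR L0 G1 Gdec GL g0 gb.
pose A := C * (2^-1 `^ (1 - g) / (1 - 2^-1 `^ (1 - g))).
exists (fun n => A * (K * a n) `^ (1 - g)); split.
  move=> n an; apply: truncated_mean_le => //; first by rewrite g0.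
  exact: mulr_gt0.
pose kap := fine (sqnorm_variance nu).
pose B := A * K `^ (1 - g).
have c1 : (T n)%:R * G (K * a n) @[n --> \oo] --> K `^ (- b).
  exact: (quantile_tail_ratio L0 Gdec GL hT ha).
have c2 : (T n)%:R * (a n) `^ (- (g + g)) @[n --> \oo] --> (0 : R).
  exact: (quantile_powR_small L0 Gdec GL hT ha).
have c3 : (a n) `^ (- g) @[n --> \oo] --> (0 : R).
  exact: cvg_comp ay (powRN_cvgy g0).
have : (T n)%:R * G (K * a n) +
   ((T n)%:R / (S n)%:R * (B ^+ 2 * ((T n)%:R * (a n) `^ (- (g + g)))) +
    (T n)%:R / (S n)%:R * (kap * (K * (B * (a n) `^ (- g))))) / eta ^+ 2
   @[n --> \oo] --> K `^ (- b) +
   (y * (B ^+ 2 * 0) + y * (kap * (K * (B * 0)))) / eta ^+ 2.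
  apply: cvgD => //; apply: cvgMl; apply: cvgD; apply: cvgM => //.
    by apply: cvgMr.
  by apply: cvgMr; apply: cvgMr; apply: cvgMr.
rewrite !mulr0 addr0 mul0r addr0; apply: cvg_trans; apply: near_eq_cvg; near=> n.
have an : 0 < a n by near: n; move/cvgryPgt : ay; apply.
have Sn : (0 < S n)%N by near: n; move/cvgnyPge : hS => /(_ 1%N).
rewrite /perturbation_bound -/G -/kap; congr (_ + _).
have -> : A * (K * a n) `^ (1 - g) = B * (a n * (a n) `^ (- g)).
  rewrite powRM ?ltW// [a n `^ (1 - g)]powRD; last by rewrite (gt_eqF an) implybT.
  by rewrite powRr1 ?ltW// /B; ring.
have -> : (a n) `^ (- (g + g)) = (a n) `^ (- g) * (a n) `^ (- g).
  by rewrite opprD powRD// (gt_eqF an) implybT.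
by field; rewrite pnatr_eq0 -lt0n Sn !gt_eqF.
Unshelve. all: by end_near. Qed.

Let lam n (w : Om n) : R :=
  lambda_max (scaled_gram (fun i => @sigma n i w) (fun i j => @Z n (i, j) w)).

Lemma small_frechet_level (e : R) : 0 < e -> exists2 K : R, 0 < K & K `^ (- b) < e.
Proof.
move=> e0; exists ((e / 2) `^ (- b^-1)); first by apply: powR_gt0; rewrite divr_gt0.
rewrite -powRrM mulrNN mulVf ?gt_eqF// powRr1; last by rewrite ltW// divr_gt0.
by rewrite ltr_pdivrMr// ltr_pMr// ltr1n.
Qed.

Lemma lambda_max_prob_bounds x eta e : 0 < x -> 0 < eta -> eta < x -> 0 < e ->
  \forall n \near \oo,
    frechet_cdf b (x - eta) - e <= fine (P n [set w | lam w <= x * ((S n)%:R * a n)])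
      <= frechet_cdf b (x + eta) + e.
Proof.
move=> x0 eta0 etax e0.
have e20 : 0 < e / 2 by rewrite divr_gt0.
have [K K0 Ke] := small_frechet_level e20.
have [Mn [hMn bnd]] := perturbation_vanishes eta0 K0.
have xm0 : 0 < x - eta by rewrite subr_gt0.
have xp0 : 0 < x + eta by rewrite addr_gt0.
have up := cvg_exp_compound_quantile L0 Gdec GL hT ha xp0.
have lo := cvg_exp_compound_quantile L0 Gdec GL hT ha xm0.
near=> n.
have an : 0 < a n by near: n; move/cvgryPgt : ay; apply.
have Sn : (0 < S n)%N by near: n; move/cvgnyPge : hS => /(_ 1%N).
have SR : 0 < (S n)%:R :> R by rewrite ltr0n.
have Ka : 0 < K * a n by rewrite mulr_gt0.
have ep : 0 < eta * ((S n)%:R * a n) by rewrite !mulr_gt0.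
have bn : perturbation_bound nu mu (T n) (S n) (K * a n) (Mn n) (eta * ((S n)%:R * a n)) < e / 2.
  by near: n; apply: (cvgr_lt _ bnd).
have h1 := lambda_max_prob_le nu_moments nu_mean nu_var (@hZ n) (@hsigma n) (@hindep n) Sn
  Ka ep (hMn n an) (x * ((S n)%:R * a n)).
have h2 := lambda_max_prob_ge nu_moments nu_mean nu_var (@hZ n) (@hsigma n) (@hindep n) Sn
  Ka ep (hMn n an) (c := x * ((S n)%:R * a n)).
have upn : (1 - G ((x + eta) * a n)) ^+ T n < frechet_cdf b (x + eta) + e / 2.
  by near: n; apply: (cvgr_lt _ up); rewrite ltrDl.
have lon : frechet_cdf b (x - eta) - e / 2 < (1 - G ((x - eta) * a n)) ^+ T n.
  by near: n; apply: (cvgr_gt _ lo); rewrite gtrBl.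
have Em : (x * ((S n)%:R * a n) - eta * ((S n)%:R * a n)) / (S n)%:R = (x - eta) * a n.
  by field; rewrite gt_eqF.
have Ep : (x * ((S n)%:R * a n) + eta * ((S n)%:R * a n)) / (S n)%:R = (x + eta) * a n.
  by field; rewrite gt_eqF.
rewrite Ep in h1; rewrite Em -mulrBl in h2.
have {}h2 := h2 (mulr_ge0 (ltW xm0) (mulr_ge0 (ltW SR) (ltW an))).
exact: (bounds_of_perturbation upn lon bn h1 h2).
Unshelve. all: by end_near. Qed.

Lemma lambda_max_prob_cvg x : 0 < x ->
  fine (P n [set w | lam w <= x * ((S n)%:R * a n)]) @[n --> \oo] --> frechet_cdf b x.
Proof.
move=> x0; apply/cvgrPdist_le => e e0.
have e20 : 0 < e / 2 by rewrite divr_gt0.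
have /cvgrPdist_lt/(_ _ e20)[r /= r0 hr] := @continuous_frechet_cdf R b x x0.
(* Half of x keeps the lower level x - eta positive. *)
pose eta := Num.min (r / 2) (x / 2).
have eta0 : 0 < eta by rewrite lt_min !divr_gt0.
have etax : eta < x by rewrite (@le_lt_trans _ _ (x / 2))// ?ge_min ?lexx ?orbT//; lra.
have etar : eta < r by rewrite (@le_lt_trans _ _ (r / 2))// ?ge_min ?lexx//; lra.
have hp : `|frechet_cdf b x - frechet_cdf b (x + eta)| < e / 2.
  by apply: hr; rewrite /= opprD addNKr normrN gtr0_norm.
have hm : `|frechet_cdf b x - frechet_cdf b (x - eta)| < e / 2.
  by apply: hr; rewrite /= opprB addrC subrK gtr0_norm.
near=> n; apply: (le_dist_of_near_bounds hp hm).
by near: n; exact: lambda_max_prob_bounds.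
Unshelve. all: by end_near. Qed.
End Limit.

Unset Implicit Arguments.
Set Strict Implicit.

(** * The limit law of the largest eigenvalue *)

Theorem theorem3p1
  (R : realType) (alpha : R) (halpha : 0 < alpha < 4) (halpha2 : alpha != 2)
  (y : R) (hy : 0 < y)
  (T S : nat -> nat)
  (hT : T n @[n --> \oo] --> \oo) (hS : S n @[n --> \oo] --> \oo)
  (hTS : (T n)%:R / (S n)%:R @[n --> \oo] --> y)
  (mu : probability R R) (hmu : power_law_tailed mu alpha)
  (nu : probability (R * R)%type R)
  (hmoments : all_moments_finite nu)
  (hmean : complex_mean nu = 0)
  (hvar : complex_variance nu = 1%E)
  (d : nat -> measure_display) (Om : forall n, measurableType (d n))
  (P : forall n, probability (Om n) R)
  (sigma : forall n, 'I_(T n) -> {RV (P n) >-> R})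
  (Z : forall n, 'I_(T n) * 'I_(S n) -> {RV (P n) >-> (R * R)%type})
  (hsigma : forall n, iid (sigma n) mu)
  (hZ : forall n, iid (Z n) nu)
  (hindep : forall n, independent_families (sigma n) (Z n))
  (a : nat -> R)
  (ha : forall n, (0 < T n)%N ->
     (1 - cdf_of_square mu (a n))%E = ((T n)%:R^-1)%:E)
  (d' : measure_display) (Om' : measurableType d') (Q : probability Om' R)
  (xi : {RV Q >-> R})
  (hxi : forall x : R, 0 < x ->
     cdf xi x = (expR (- (x `^ (- (alpha / 2)))))%:E) :
  cvg_in_distribution P
    (fun n (w : Om n) =>
       let Sigma := diag_matrix (fun i => sigma n i w) in
       let Zmx := complex_matrix (fun i j => Z n (i, j) w) in
       lambda_max (Sigma *m Zmx *m adjoint Zmx *m Sigma)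
         / ((S n)%:R * a n))
    xi.
Proof.
have a0 : 0 < alpha by case/andP : halpha.
have [L L0 GL] := power_law_tail_of_square a0 hmu.
set b := alpha / 2 in GL hxi.
have b02 : 0 < b < 2.
  by rewrite /b; case/andP : halpha => h1 h2; apply/andP; split; lra.
have b0 : 0 < b by case/andP : b02.
have ha' n : (0 < T n)%N -> tail_of_square mu (a n) = (T n)%:R^-1.
  move=> Tn; have := ha n Tn; rewrite cdf_of_squareE => h; apply/eqP.
  by rewrite -eqe -h -EFinB subKr.
have Gdec := @tail_of_square_nonincreasing _ mu.
have ay : a n @[n --> \oo] --> +oo := quantile_cvgy L0 Gdec GL hT ha'.
pose lam n (w : Om n) : R :=
  lambda_max (scaled_gram (fun i => sigma n i w) (fun i j => Z n (i, j) w)).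
have mlam n : measurable_fun [set: Om n] (@lam n) by exact: measurable_sample_lambda_max.
pose X n (w : Om n) : R := lam n w / ((S n)%:R * a n).
have mX n : measurable_fun [set: Om n] (X n).
  by apply: measurable_funM => //; exact: mlam.
have cdf_pos x : 0 < x -> cdf xi x = (frechet_cdf b x)%:E by move=> x0; exact: hxi.
have Sa_gt0 : \forall n \near \oo, 0 < (S n)%:R * a n.
  near=> n; rewrite mulr_gt0//.
    by rewrite ltr0n; near: n; move/cvgnyPge : hS => /(_ 1%N).
  by near: n; move/cvgryPgt : ay; apply.
have pX x : 0 < x -> fine (P n (X n @^-1` `]-oo, x])) @[n --> \oo] --> frechet_cdf b x.
  move=> x0; apply: cvg_trans (lambda_max_prob_cvg b02 L0 GL hT hS hTS hmoments hmean hvar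
    hsigma hZ hindep ha' x0).
  apply: near_eq_cvg; near=> n.
  have Sa : 0 < (S n)%:R * a n by near: n.
  congr (fine (P n _)); apply/seteqP; split => w /=; rewrite in_itv/= /X ler_pdivrMr//.
split; first exact: mX.
move=> x _.
have mXx n : measurable (X n @^-1` `]-oo, x]).
  by rewrite -[_ @^-1` _]setTI; exact: mX.
have [l [lE hl]] : exists l : R, cdf xi x = l%:E /\
    fine (P n (X n @^-1` `]-oo, x])) @[n --> \oo] --> l.
  have [x0|x0] := ltP 0 x; first by exists (frechet_cdf b x); split; [exact: cdf_pos|exact: pX].
  (* For x <= 0 both sides are squeezed by their values at small positive levels. *)
  exists 0; split.
    apply/eqP; rewrite eq_le measure_ge0 andbT; apply/lee_addgt0Pr => e e0.
    have [v v0 ve] := frechet_cdf_small b0 e0.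
    rewrite add0e; apply: (@le_trans _ _ (cdf xi v)).
      by apply: cdf_nondecreasing; exact: le_trans (ltW v0).
    by rewrite cdf_pos// lee_fin ltW.
  apply/cvgrPdist_le => e e0.
  have e20 : 0 < e / 2 by rewrite divr_gt0.
  have [v v0 ve] := frechet_cdf_small b0 e20.
  near=> n.
  have hv : fine (P n (X n @^-1` `]-oo, v])) < e.
    near: n; apply: (cvgr_lt _ (pX v v0)); lra.
  rewrite sub0r normrN ger0_norm; last exact/fine_ge0/measure_ge0.
  apply: le_trans (ltW hv); rewrite fine_le ?fin_num_measure//.
    by rewrite -[_ @^-1` _]setTI; exact: mX.
  rewrite le_measure ?inE//; first by rewrite -[_ @^-1` _]setTI; exact: mX.
  move=> w /=; rewrite !in_itv/= => /le_trans; apply; exact: le_trans (ltW v0).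
rewrite lE; apply: cvg_trans (cvg_comp _ _ hl (_ : EFin u @[u --> l] --> l%:E)).
  apply: near_eq_cvg; near=> n => /=.
  by rewrite fineK// fin_num_measure.
by [].
Unshelve. all: by end_near. Qed.
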